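(* Let $\mathcal{T}$ be an infinite, locally finite, rooted tree, and let $M\in\mathbb{N}=\{0,1,2,\dots\}$. If $br_r(\mathcal{T})<M+1$ then the $M$-digging random walk ($M$-DRW) on $\mathcal{T}$ is recurrent, and if $br_r(\mathcal{T})>M+1$ then the $M$-DRW on $\mathcal{T}$ is transient.
   Context: Tree notation: $\mathcal{T}=(V,E)$ has root $\varrho$; $|\nu|$ is the graph distance from $\nu\in V$ to $\varrho$; each edge $e$ has endpoints $e^-,e^+$ with $|e^+|=|e^-|+1$, and $|e|:=|e^+|$. A cutset is a set $\pi$ of edges such that every infinite self-avoiding path $(\nu_i)_{i\ge 0}$ started at $\varrho$ has exactly one $i\ge1$ with $[\nu_{i-1},\nu_i]\in\pi$; $\Pi$ is the set of cutsets. The branching-ruin number is $$br_r(\mathcal{T})=\sup\Big\{\gamma>0:\ \inf_{\pi\in\Pi}\sum_{e\in\pi}|e|^{-\gamma}>0\Big\}\in[0,\infty]\qquad(\sup\emptyset=0).$$ $M$-DRW: put $m_\varrho=0$ and $m_\nu=M$ for $\nu\in V\setminus\{\varrho\}$ ($m_\nu$ is the initial number of cookies at $\nu$). The walk $\mathbf{X}=(X_n)_{n\ge0}$ starts at $X_0=\varrho$. Each time it visits a vertex with a cookie left, it eats one cookie and then jumps to the parent of that vertex; if no cookie is left there, it jumps to a uniformly chosen neighbor. Formally, let $\ell_n(\nu)=|\{k\in\{0,\dots,n\}:X_k=\nu\}|$ and $W_n(e)=1-\mathbf{1}_{\{\ell_n(e^-)\le m_{e^-}\}}$; on $\{X_n=\nu\}$,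 for $\mu\sim\nu$, $$\mathbb{P}(X_{n+1}=\mu\mid X_0,\dots,X_n)=\frac{W_n([\nu,\mu])}{\sum_{\mu'\sim\nu}W_n([\nu,\mu'])}.$$ Recurrence/transience: let $\sigma_0=0$, $\sigma_{n+1}=\inf\{k>\sigma_n: X_k\ne X_{\sigma_n},\ \ell_k(X_k)\ge m_{X_k}+1\}$, $\widetilde X_n=X_{\sigma_n}$, and $T(\varrho)=\inf\{k\ge1:\widetilde X_k=\varrho\}$. The walk $\mathbf{X}$ is transient if $\mathbb{P}(T(\varrho)=\infty)>0$, and recurrent otherwise. *)

(* Defs.v *)
From HB Require Import structures.
From mathcomp Require Export all_boot all_order all_algebra.
From mathcomp Require Export all_classical all_reals all_analysis.

Set Implicit Arguments.
Unset Strict Implicit.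
Unset Printing Implicit Defensive.

Import Order.TTheory GRing.Theory Num.Theory.

Local Open Scope classical_set_scope.
Local Open Scope ring_scope.

Record rooted_tree := RootedTree {
  vertex :> choiceType ;
  adj : rel vertex ;
  root : vertex ;
  adj_sym : symmetric adj ;
  adj_irrefl : irreflexive adj ;
  tree_connected : forall u v, exists p, path adj u p /\ last u p = v ;
  (* [ucycle adj [:: u; v]] holds as soon as [adj u v]; a genuine graph cycle
     has at least three vertices *)
  tree_acyclic : forall c, ucycle adj c -> (size c < 3)%N
}.
Arguments root {_}.
Arguments adj {_}.

Definition infinite_tree (T : rooted_tree) := infinite_set [set: T].

Definition locally_finite (T : rooted_tree) :=
  forall v : T, finite_set [set u | adj v u].

(* The least element of A, with None standing for inf set0 = +oo. *)
Definition inf_nat (A : set nat) : option nat :=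
  match pselect (exists n, `[< A n >]) with
  | left h => Some (ex_minn h)
  | right _ => None
  end.

Section Tree.
Context {T : rooted_tree}.
Implicit Types (u v : T) (e : T * T) (pi : set (T * T)).

(* The default value is never used, by tree_connected. *)
Definition dist u v : nat :=
  odflt 0%N (inf_nat
    [set n | exists p, [/\ path adj u p, last u p = v & size p = n]]).

Definition depth v := dist v root.

(* An edge e is represented by the pair (e^-, e^+). *)
Definition edges : set (T * T) :=
  [set e | adj e.1 e.2 /\ depth e.2 = (depth e.1).+1].

(* [u, v] for u ~ v; the depths of adjacent vertices differ by exactly one. *)
Definition edge u v : T * T := if (depth u < depth v)%N then (u, v) else (v, u).

Definition edge_depth e : nat := depth e.2.

Definition infinite_path_from_root (nu : nat -> T) :=
  [/\ nu 0%N = root, forall i, adj (nu i) (nu i.+1) & injective nu].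

Definition is_cutset pi :=
  pi `<=` edges /\
  forall nu, infinite_path_from_root nu ->
    exists! i, (1 <= i)%N /\ pi (edge (nu i.-1) (nu i)).

End Tree.

Section BranchingRuin.
Variables (R : realType) (T : rooted_tree).
Local Open Scope ereal_scope.

(* A cutset may be infinite (it may contain arbitrary edges that lie on no
   infinite path), hence the sum in \bar R. *)
Definition cutset_sum (gamma : R) (pi : set (T * T)) : \bar R :=
  \esum_(e in pi) (((edge_depth e)%:R : R) `^ (- gamma))%:E.

Definition br_r : \bar R :=
  maxe 0 (ereal_sup [set gamma%:E | gamma in [set g : R | (0 < g)%R /\
    0 < ereal_inf [set cutset_sum g pi | pi in is_cutset]]]).

End BranchingRuin.

Section Walk.
Context {T : rooted_tree}.
Variable M : nat.
Implicit Types (x : nat -> T) (u v : T) (n : nat).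

Definition cookies v : nat := if v == root then 0%N else M.

Definition local_time x n v : nat := (\sum_(k < n.+1) (x k == v))%N.

Definition weight x n (e : T * T) : nat :=
  (1 - (local_time x n e.1 <= cookies e.1))%N.

Definition step_prob (R : realType) x n v : R :=
  ((weight x n (edge (x n) v))%:R : R) /
  \sum_(u \in [set u | adj (x n) u])
    ((weight x n (edge (x n) u))%:R : R).

(* None stands for the value +oo. *)
Fixpoint sigma x n : option nat :=
  if n is n'.+1 then
    if sigma x n' is Some s then
      inf_nat [set k | [/\ (s < k)%N, x k <> x s &
                           (cookies (x k) + 1 <= local_time x k (x k))%N]]
    else None
  else Some 0%N.

Definition xtilde x n : option T := omap x (sigma x n).

Definition return_time x : option nat :=
  inf_nat [set k | (1 <= k)%N /\ xtilde x k = Some root].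

Section Process.
Context {R : realType} {d : measure_display} {Omega : measurableType d}.
Variables (P : probability Omega R) (X : nat -> Omega -> T).

Definition history n x : set Omega :=
  [set w | forall k, (k <= n)%N -> X k w = x k].

Definition cond_prob (A B : set Omega) : R :=
  fine (P (A `&` B)) / fine (P B).

(* The vertex set of a connected locally finite graph is countable, so
   measurability of X n is measurability of its fibres, and conditioning on
   X 0, ..., X n is conditioning on the non-null histories. *)
Definition is_DRW :=
  [/\ forall n v, measurable (X n @^-1` [set v]),
      forall w, X 0%N w = root &
      forall n x v, adj (x n) v -> (0 < P (history n x))%E ->
        cond_prob (X n.+1 @^-1` [set v]) (history n x) = step_prob R x n v].

Definition transient : Prop :=
  (0 < P [set w | return_time (fun n => X n w) = None])%E.

Definition recurrent : Prop := ~ transient.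

End Process.
End Walk.

(* Main.v *)
Require Import Defs.
From mathcomp Require Import all_boot all_order all_algebra.
From mathcomp Require Import all_classical all_reals all_analysis.
From mathcomp Require Import zify ring lra.

(** The walk is studied through its finite histories. A vertex is entered only when
    its parent has no cookie left ([reachable_parent]), so from a given history the
    walk jumps uniformly to the vertices of [moves] ([step_probE]), and the
    probability of an event about finitely many steps is obtained by iterating the
    transition operator [step] ([prob_expect]). The return time is infinite exactly if
    the walk stays [alive] forever, that is, never visits the root after the first
    time that another vertex is dug ([return_time_alive]).

    The main tool is a family of supermartingales. Let [S >= 0] be superharmonic off
    the root and vanish there. Eating a cookie at [u] throws the walk back from [u] to
    its parent, and the product [hval] of the current value of [S] with all the ratios
    [S u / S (parent u)] lost in this way is a supermartingale
    ([hval_superharmonic]), and a martingale where [S] is harmonic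
    ([hval_harmonic]). For the function [S = meetS v], which increases linearly along
    the way from the root to [v], this shows that [v] is dug before the walk dies with
    probability at most [|v| ^- (M + 1)] ([expect_exitv]): one factor [|v| ^-1] as for
    simple random walk on a line, and one more for each cookie.

    If [br_r < M + 1], there are cutsets [pi] for which the sum of
    [|e| ^- (M + 1)] is arbitrarily small. The part of the tree above [pi] is finite
    ([uncut_finite]), and a walk confined to it dies almost surely
    ([expect_inside]); hence the probability to live forever is at most that sum
    ([expect_alive_cutset]).

    If [br_r > M + 1], take [g > M + 1] for which the sums of [|e| ^- g] over the
    cutsets are bounded below. By max-flow min-cut ([root_cut_sum], [flow_bound],
    [flow_conserved]) a child [c] of the root carries, for every level, a flow to that
    level whose total is bounded below and whose value at each [u] is at most
    [|u| ^- g]. The corresponding mixture [Z] of the martingales [hval] of the vertices of the level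
    vanishes when the walk dies. The digging of two vertices that branch at depth [b]
    is quasi-independent given that their meet is dug ([hval_pair]), which bounds the
    second moment of [Z] by the flow's total times the sum of
    [(k ^+ (M + 1) - (k - 1) ^+ (M + 1)) * k `^ (- g)] ([energy_le]); this
    series converges ([energy_series]). Therefore the walk survives with a probability
    bounded below uniformly in time ([alive_ge], [expect_alive_lower]). *)

Set Implicit Arguments.
Unset Strict Implicit.
Unset Printing Implicit Defensive.

Import Order.TTheory GRing.Theory Num.Theory.

Local Open Scope ring_scope.

Local Notation root := (@Defs.root _).

Lemma inf_natP (A : set nat) n :
  (inf_nat A = Some n) <-> A n /\ forall m, A m -> (n <= m)%N.
Proof.
rewrite /inf_nat; case: pselect => [h|h].
  case: ex_minnP => k /asboolP Ak kmin; split=> [[<-]|[An nmin]].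
    by split=> // m Am; apply: kmin; apply/asboolP.
  congr Some; apply/eqP; rewrite eqn_leq nmin // andbT; apply: kmin.
  exact/asboolP.
by split=> // -[An _]; case: h; exists n; apply/asboolP.
Qed.

Lemma inf_nat_ex (A : set nat) n : A n -> exists m, inf_nat A = Some m.
Proof.
move=> An; rewrite /inf_nat; case: pselect => [h|[]]; first by eexists.
by exists n; apply/asboolP.
Qed.

Lemma inf_nat_None (A : set nat) : (inf_nat A = None) <-> forall n, ~ A n.
Proof.
split=> [A0 n /inf_nat_ex [m]|A0]; first by rewrite A0.
by case E: (inf_nat A) => [m|//]; case/inf_natP: E => /A0.
Qed.

(** * Rooted trees *)

Section TreeStructure.
Variable T : rooted_tree.
Implicit Types (u v x y : T).

Lemma depth_path v : exists p, [/\ path adj v p, last v p = root & size p = depth v].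
Proof.
rewrite /depth /dist.
have [p [pp lp]] := tree_connected v root.
have [m mE] := @inf_nat_ex [set n | exists p, [/\ path adj v p, last v p = root & size p = n]]
  (size p) (ex_intro _ p (And3 pp lp erefl)).
by rewrite mE /=; case/inf_natP: mE.
Qed.

Lemma depth_le v p : path adj v p -> last v p = root -> (depth v <= size p)%N.
Proof.
move=> pp lp; rewrite /depth /dist.
have [m mE] := @inf_nat_ex [set n | exists p, [/\ path adj v p, last v p = root & size p = n]]
  (size p) (ex_intro _ p (And3 pp lp erefl)).
rewrite mE /=; case/inf_natP: mE => _; apply; by exists p.
Qed.

Lemma depth_root : depth (root : T) = 0%N.
Proof. by apply/eqP; rewrite -leqn0 (@depth_le root [::]). Qed.

Lemma depth_eq0 v : (depth v == 0%N) = (v == root).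
Proof.
apply/eqP/eqP => [d0|->]; last exact: depth_root.
have [p [_ lp]] := depth_path v.
by rewrite d0 => /size0nil p0; rewrite p0 in lp.
Qed.

Lemma depth_adj u v : adj u v -> (depth u <= (depth v).+1)%N.
Proof.
move=> uv; have [p [pp lp sp]] := depth_path v.
by rewrite -sp; apply: (@depth_le u (v :: p)) => //=; rewrite uv.
Qed.

Lemma ex_parent v : v != root ->
  exists u, adj v u /\ depth v = (depth u).+1.
Proof.
move=> vr; have [[|u p] [/= pp lp sp]] := depth_path v; first by rewrite lp eqxx in vr.
case/andP: pp => vu pu; exists u; split=> //.
by apply/eqP; rewrite eqn_leq depth_adj //= -sp ltnS; apply: depth_le.
Qed.

Lemma path_below v u : (depth u <= depth v)%N -> u != v ->
  exists p, path [rel x y | [&& adj x y, x != v & y != v]] u p /\ last u p = root.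
Proof.
move=> uv nuv; have [p [pp lp sp]] := depth_path u.
exists p; split=> //; elim: p u uv nuv pp lp sp => //= y p IHp u uv nuv.
case/andP=> uy pp lp sp; rewrite uy nuv /=.
have yp : (depth y <= size p)%N by apply: depth_le.
have yv : y != v by apply: contraTneq uv => <-; rewrite -ltnNge -sp ltnS.
rewrite yv /=; apply: IHp => //.
  by apply: leq_trans uv; rewrite -sp; apply: leq_trans yp (leqnSn _).
by apply/eqP; rewrite eqn_leq yp andbT -ltnS sp depth_adj.
Qed.

(** Acyclicity enters only here. Shortest paths to the root from two distinct
    neighbours that are not deeper than [v] avoid [v], so they would close a cycle
    through [v]. *)
Lemma lower_neighbour_uniq v u u' : adj v u -> adj v u' ->
  (depth u <= depth v)%N -> (depth u' <= depth v)%N -> u = u'.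
Proof.
move=> vu vu' du du'; apply/eqP/negPn/negP => nuu'.
have nu : u != v by apply: contraTneq vu => ->; rewrite adj_irrefl.
have nu' : u' != v by apply: contraTneq vu' => ->; rewrite adj_irrefl.
set e := [rel x y | [&& adj x y, x != v & y != v]].
have es : symmetric e by move=> x y /=; rewrite adj_sym [(x != v) && _]andbC.
have [p [pp lp]] := path_below du nu.
have [p' [pp' lp']] := path_below du' nu'.
have : exists q, path e u q /\ last u q = u'.
  exists (p ++ rev (belast u' p')).
  have pr : path e root (rev (belast u' p')).
    by rewrite -lp' rev_path (eq_path (e' := e)) // => x y; exact: es.
  rewrite cat_path lp pr andbT last_cat lp; split=> //.
  case: p' lp' {pp' pr} => [|a p'] //= _.
  by rewrite rev_cons last_rcons.
case=> q [pq lq]; case: (shortenP pq) lq => {}q {}pq uq _ lq.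
have vq : all (fun y => y != v) (u :: q).
  elim: q u nu pq {uq lq vu nuu' du p pp lp} => /= [|y q IHq] u nu; first by rewrite nu.
  by case/andP=> /and3P [_ _ yv] pq; rewrite nu IHq.
have /tree_acyclic : ucycle adj [:: v, u & q].
  apply/andP; split; last first.
    rewrite cons_uniq uq andbT; apply: contraL vq => vq.
    by apply/allPn; exists v => //; rewrite negbK.
  rewrite /= vu rcons_path lq adj_sym vu' andbT.
  by apply: sub_path pq => x y /= /and3P [].
by case: q lq {pq uq vq} => //= lq; rewrite lq eqxx in nuu'.
Qed.

Definition parent v : T :=
  if pselect (exists u, adj v u /\ depth v = (depth u).+1) is left h
  then projT1 (cid h) else root.

Lemma adj_parent v : v != root -> adj v (parent v).
Proof.
move=> /ex_parent vr; rewrite /parent; case: pselect => // h.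
by case: cid => /= u [].
Qed.

Lemma depth_parent v : v != root -> depth v = (depth (parent v)).+1.
Proof.
move=> /ex_parent vr; rewrite /parent; case: pselect => // h.
by case: cid => /= u [].
Qed.

Lemma parent_root : parent root = root.
Proof.
rewrite /parent; case: pselect => // h; case: cid => /= u [_].
by rewrite depth_root.
Qed.

Lemma adjP u v : adj u v = ((u != root) && (v == parent u)) || ((v != root) && (u == parent v)).
Proof.
apply/idP/idP => [uv|/orP[] /andP[nr /eqP->]]; last 2 first.
- exact: adj_parent.
- by rewrite adj_sym adj_parent.
have key a b : adj a b -> (depth b <= depth a)%N -> (a != root) && (b == parent a).
  move=> ab ba.
  have ar : a != root.
    apply: contraTneq ab => ar; move: ba; rewrite ar depth_root leqn0 depth_eq0.
    by move=> /eqP ->; rewrite adj_irrefl.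
  rewrite ar /=; apply/eqP; apply: (lower_neighbour_uniq ab) => //.
    exact: adj_parent.
  by rewrite (depth_parent ar).
have [uv'|/ltnW vu] := leqP (depth u) (depth v).
  by rewrite [X in _ || X]key ?orbT // adj_sym.
by rewrite key.
Qed.

Lemma depth_parentE v : depth (parent v) = (depth v).-1.
Proof.
have [->|vr] := eqVneq v root; first by rewrite parent_root depth_root.
by rewrite (depth_parent vr).
Qed.

Lemma depth_iter_parent k v : depth (iter k parent v) = (depth v - k)%N.
Proof. by elim: k => [|k IHk] /=; rewrite ?subn0 // depth_parentE IHk subnS. Qed.

(** The ancestor of [v] at depth [k], when [k <= depth v]; it is [v] for larger [k]. *)
Definition up k v := iter (depth v - k) parent v.
Definition anc u v := up (depth u) v == u.

Lemma depth_up k v : (k <= depth v)%N -> depth (up k v) = k.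
Proof. by move=> kv; rewrite depth_iter_parent subKn. Qed.

Lemma up_up j k v : (j <= k <= depth v)%N -> up j (up k v) = up j v.
Proof.
case/andP=> jk kv; rewrite /up depth_up // -iterD; congr (iter _ parent v).
by lia.
Qed.

Lemma up_depth v : up (depth v) v = v. Proof. by rewrite /up subnn. Qed.

Lemma up0 v : up 0 v = root.
Proof. by apply/eqP; rewrite -depth_eq0 depth_up. Qed.

Lemma up_parent k v : (k < depth v)%N -> up k (parent v) = up k v.
Proof.
move=> kv; rewrite /up -iterSr depth_parentE; congr (iter _ parent v).
by lia.
Qed.

Lemma parent_up j v : (0 < j <= depth v)%N -> parent (up j v) = up j.-1 v.
Proof. by case/andP=> j0 jv; rewrite /up -iterS; congr (iter _ parent v); lia. Qed.

Lemma anc_refl v : anc v v. Proof. by rewrite /anc up_depth. Qed.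

Lemma anc_depth u v : anc u v -> (depth u <= depth v)%N.
Proof.
move=> /eqP uv; rewrite leqNgt; apply/negP => vu.
by move: (congr1 depth uv); rewrite depth_iter_parent; lia.
Qed.

Lemma anc_up k v : anc (up k v) v.
Proof.
rewrite /anc; have [kv|/ltnW vk] := leqP k (depth v); first by rewrite depth_up.
by rewrite /up (_ : depth v - k = 0)%N ?subnn //; apply/eqP.
Qed.

Lemma ancP k u v : anc u v -> depth u = k -> u = up k v.
Proof. by move=> /eqP uv <-. Qed.

Lemma anc_trans u v w : anc u v -> anc v w -> anc u w.
Proof.
move=> uv vw; have duv := anc_depth uv; have dvw := anc_depth vw.
by rewrite /anc -(@up_up _ (depth v)) ?duv // -(ancP vw erefl).
Qed.

Lemma anc_total u v w : anc u w -> anc v w -> (depth u <= depth v)%N -> anc u v.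
Proof.
move=> uw vw duv; rewrite /anc (ancP vw erefl) up_up ?duv ?anc_depth //.
Qed.

Lemma anc_eq u v : anc u v -> (depth v <= depth u)%N -> u = v.
Proof.
move=> uv dvu; rewrite (ancP uv erefl).
by rewrite (_ : depth u = depth v) ?up_depth //; apply/eqP; rewrite eqn_leq dvu anc_depth.
Qed.

Lemma anc_root v : anc root v. Proof. by rewrite /anc depth_root up0. Qed.

Lemma anc_parentl v : anc (parent v) v.
Proof.
have [->|vr] := eqVneq v root; first by rewrite parent_root anc_refl.
rewrite /anc /up (_ : depth v - depth (parent v) = 1)%N //.
by rewrite (depth_parent vr); lia.
Qed.

Lemma anc_parent u v : v != root -> anc u v = (u == v) || anc u (parent v).
Proof.
move=> vr; apply/idP/orP => [uv|[/eqP->|uv]]; last 2 first.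
- exact: anc_refl.
- exact: anc_trans uv (anc_parentl v).
have := anc_depth uv; rewrite leq_eqVlt => /orP[/eqP e|lt].
  by left; apply/eqP/anc_eq => //; rewrite e.
right; apply: (anc_total uv (anc_parentl v)).
by rewrite -ltnS -depth_parent.
Qed.

(** The depth of the last common ancestor of [x] and [v], counted as the number of
    ancestors of [x] below the root that are also ancestors of [v]; in this form its
    increments along edges, hence its harmonicity, are immediate. *)
Definition meetd x v : nat := (\sum_(i < depth x) anc (iter i parent x) v)%N.

Lemma meetd_root v : meetd root v = 0%N.
Proof. by rewrite /meetd depth_root big_ord0. Qed.

Lemma meetd_parent x v : x != root -> meetd x v = (anc x v + meetd (parent x) v)%N.
Proof.
move=> xr; rewrite /meetd (depth_parent xr) big_ord_recl /=; congr addn.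
by apply: eq_bigr => i _; rewrite -iterSr.
Qed.

Lemma tree_ind (Q : T -> Prop) : Q root -> (forall v, v != root -> Q (parent v) -> Q v) ->
  forall v, Q v.
Proof.
move=> Qr Qp v; elim: {v}(depth v) {-2}v (erefl (depth v)) => [|k IHk] v dv.
  by move/eqP: dv; rewrite depth_eq0 => /eqP->.
have vr : v != root by rewrite -depth_eq0 dv.
by apply: Qp => //; apply: IHk; rewrite depth_parentE dv.
Qed.

(** This characterization makes [meetd] symmetric and compares it along branches. *)
Lemma leq_meetd k x v :
  (k <= meetd x v)%N = [&& (k <= depth x)%N, (k <= depth v)%N & up k x == up k v].
Proof.
elim/tree_ind: x k => [|x xr IHx] k.
  rewrite meetd_root depth_root; case: k => // ; by rewrite !up0 eqxx.
rewrite meetd_parent //; case: (boolP (anc x v)) => [xv|xv] /=.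
  have E : (meetd (parent x) v = depth (parent x))%N.
    have px := anc_trans (anc_parentl x) xv.
    apply/eqP; rewrite eqn_leq; apply/andP; split; last first.
      by rewrite IHx leqnn anc_depth //= up_depth eq_sym; exact: px.
    by have := leqnn (meetd (parent x) v); rewrite {1}IHx => /and3P[].
  rewrite E add1n -depth_parent //; have [kx|] //= := leqP k (depth x).
  rewrite (leq_trans kx (anc_depth xv)) /= (ancP xv erefl) up_up ?eqxx //.
  by rewrite kx anc_depth.
rewrite add0n IHx; have [kx|xk|kx] := ltngtP k (depth x).
- by rewrite up_parent // depth_parentE (_ : (k <= (depth x).-1)%N) //; lia.
- by rewrite depth_parentE; case: leqP => //; lia.
- rewrite depth_parentE kx (_ : (depth x <= (depth x).-1)%N = false) /=; last first.
    by apply/negbTE; rewrite -ltnNge prednK // lt0n depth_eq0.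
  by rewrite up_depth eq_sym -/(anc x v) (negbTE xv) andbF.
Qed.

Lemma meetdC x v : meetd x v = meetd v x.
Proof.
apply/eqP; rewrite eqn_leq; apply/andP; split; rewrite leq_meetd.
  by have := leqnn (meetd x v); rewrite {1}leq_meetd => /and3P[-> -> /eqP->]/=.
by have := leqnn (meetd v x); rewrite {1}leq_meetd => /and3P[-> -> /eqP->]/=.
Qed.

Lemma meetd_anc x v : anc x v -> meetd x v = depth x.
Proof.
move=> xv; apply/eqP; rewrite eqn_leq leq_meetd leqnn anc_depth //= up_depth.
rewrite eq_sym -/(anc x v) xv andbT.
by have := leqnn (meetd x v); rewrite leq_meetd => /and3P[].
Qed.

Lemma meetd_min x v v' : (minn (meetd x v) (meetd x v') <= meetd v v')%N.
Proof.
set k := minn _ _.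
have : (k <= meetd x v)%N by rewrite geq_minl.
have : (k <= meetd x v')%N by rewrite geq_minr.
by rewrite !leq_meetd => /and3P[_ -> /eqP <-] /and3P[_ -> /eqP <-]/=.
Qed.

Lemma meetd_up j v v' : (j <= depth v')%N -> meetd (up j v') v = minn j (meetd v v').
Proof.
move=> jv; apply/eqP; rewrite eqn_leq leq_min -andbA; apply/and3P; split.
- by have := leqnn (meetd (up j v') v); rewrite leq_meetd depth_up // => /and3P[].
- have := leqnn (meetd (up j v') v); rewrite leq_meetd => /and3P[k1 k2 /eqP k3].
  rewrite leq_meetd k2; rewrite depth_up // in k1.
  by rewrite (leq_trans k1 jv) -k3 up_up ?k1 ?eqxx.
set k := minn _ _; have kj : (k <= j)%N by rewrite geq_minl.
have : (k <= meetd v v')%N by rewrite geq_minr.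
by rewrite !leq_meetd => /and3P[k1 k2 /eqP k3]; rewrite depth_up // kj k1 up_up ?kj // k3 eqxx.
Qed.

End TreeStructure.

Arguments parent {T} v.

Section Neighbours.
Variable T : rooted_tree.
Hypothesis lf : locally_finite T.
Implicit Types (u v x : T).

Definition nb v : seq T := finmap.enum_fset (fset_set [set u | adj v u]%classic).
Definition ch v : seq T := [seq u <- nb v | (u != root) && (parent u == v)].

Lemma mem_nb v u : (u \in nb v) = adj v u.
Proof.
by rewrite /nb (in_fset_set (lf v)); apply/idP/idP; rewrite in_setE.
Qed.

Lemma nb_uniq v : uniq (nb v).
Proof. exact: finmap.fset_uniq. Qed.

Lemma mem_ch v u : (u \in ch v) = (u != root) && (parent u == v).
Proof.
rewrite mem_filter mem_nb; case: (boolP ((u != root) && _)) => //= /andP[ur /eqP <-].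
by rewrite adj_sym adj_parent.
Qed.

Lemma ch_uniq v : uniq (ch v).
Proof. by rewrite filter_uniq // nb_uniq. Qed.

Lemma perm_nb x : x != root -> perm_eq (nb x) (parent x :: ch x).
Proof.
move=> xr; apply: uniq_perm => [||u]; first exact: nb_uniq.
  rewrite /= ch_uniq andbT mem_ch; apply/negP => /andP[pr /eqP e].
  by move: (depth_parent pr); rewrite e (depth_parent xr); lia.
rewrite mem_nb inE mem_ch adjP xr /= [x == parent u]eq_sym.
by [].
Qed.

Lemma ch_root : ch root = nb root.
Proof.
apply/all_filterP/allP => u; rewrite mem_nb adjP eqxx /= => /andP[-> /eqP ->].
exact: eqxx.
Qed.

Lemma depth_ch x u : u \in ch x -> depth u = (depth x).+1.
Proof. by rewrite mem_ch => /andP[ur /eqP <-]; exact: depth_parent. Qed.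

Lemma size_nb x : x != root -> size (nb x) = (size (ch x)).+1.
Proof. by move=> xr; rewrite (perm_size (perm_nb xr)). Qed.

Lemma nb_root_gt0 : infinite_tree T -> (0 < size (nb root))%N.
Proof.
move=> infT; rewrite lt0n size_eq0; apply/negP => /eqP nb0; apply: infT.
apply: (@sub_finite_set _ _ [set root]%classic); last exact: finite_set1.
move=> v _ /=; apply/eqP/negPn/negP => vr.
have d1 : (1 <= depth v)%N by rewrite lt0n depth_eq0.
have : up 1 v \in nb root.
  have dup := depth_up d1.
  have r1 : up 1 v != root by rewrite -depth_eq0 dup.
  rewrite -ch_root mem_ch r1 -depth_eq0 depth_parentE dup.
  by [].
by rewrite nb0.
Qed.

Lemma nb_gt0 x : infinite_tree T -> (0 < size (nb x))%N.
Proof.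
move=> infT; have [->|xr] := eqVneq x root; first exact: nb_root_gt0.
by rewrite size_nb.
Qed.

Lemma count_ch_anc x v : count (fun u => anc u v) (ch x) = anc x v && (x != v).
Proof.
case: (boolP (anc x v && (x != v))) => [/andP[xv nxv]|nxv].
  have dxv : (depth x < depth v)%N.
    rewrite ltnNge; apply: contra nxv => vx; apply/eqP; exact: anc_eq.
  have dup := depth_up dxv.
  rewrite (@eq_in_count _ _ (pred1 (up (depth x).+1 v))) => [|u /depth_ch du /=].
    rewrite count_uniq_mem ?ch_uniq // mem_ch -depth_eq0 dup /=.
    have -> : parent (up (depth x).+1 v) = x.
      by rewrite [RHS](ancP xv erefl) /up -iterS; congr (iter _ parent v); lia.
    by rewrite eqxx.
  by apply/idP/eqP => [uv|->]; [exact: ancP|exact: anc_up].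
apply/eqP; rewrite -leqn0 leqNgt -has_count; apply: contra nxv => /hasP[u].
move=> uch uv; have du := depth_ch uch; move: uch; rewrite mem_ch => /andP[ur /eqP <-].
rewrite (anc_trans (anc_parentl u) uv) /=; apply: contraTneq uv => <-.
by apply/negP => /anc_depth; rewrite (depth_parent ur) ltnn.
Qed.

End Neighbours.

(** * Histories and their transition operator *)

Section Walk.
Variable T : rooted_tree.
Hypothesis lf : locally_finite T.
Hypothesis infT : infinite_tree T.
Variable M : nat.
Variable R : realType.
Implicit Types (u v x : T) (s : seq T) (F G : seq T -> R).

(** Histories are lists of visited vertices, the most recent one first. A vertex is
    dug when it has been visited more often than it had cookies, the current visit
    included: this is the condition under which the walk leaves it uniformly. *)
Definition dug s v : bool := (cookies M v < count_mem v s)%N.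

(** From histories that the walk can produce, each step is uniform over these
    vertices; see [step_probE]. *)
Definition moves s : seq T :=
  let x := head root s in if dug s x then nb x else [:: parent x].

(** The transition operator on functions of the history. *)
Definition step F s : R := (\sum_(u <- moves s) F (u :: s)) / (size (moves s))%:R.

Definition expect n F s : R := iter n step F s.

Fixpoint reachable s : bool :=
  match s with
  | [::] => false
  | [:: u] => u == root
  | u :: s' => reachable s' && (u \in moves s')
  end.

Definition started s : bool := has (fun v => (v != root) && dug s v) s.

(** The walk dies when it is at the root after some other vertex has been dug. Its
    visits to the root before that time are not returns of the walk with the digging
    steps removed; see [return_time_alive]. *)
Fixpoint alive s : bool :=
  if s is u :: s' then alive s' && ~~ (started s' && (u == root)) else true.

Lemma dug_mem s v : dug s v -> v \in s.
Proof. by move=> sv; rewrite -has_pred1 has_count (leq_ltn_trans _ sv). Qed.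

Lemma dug_cons s u v : dug s v -> dug (u :: s) v.
Proof. by move=> sv; rewrite /dug /= (leq_trans sv) // leq_addl. Qed.

Lemma dug_consN s u v : u != v -> dug (u :: s) v = dug s v.
Proof. by move=> /negbTE uv; rewrite /dug /= uv. Qed.

Lemma startedP s : reflect (exists2 v, v != root & dug s v) (started s).
Proof.
apply: (iffP hasP) => [[v _ /andP[]]|[v vr sv]]; first by exists v.
by exists v; rewrite ?vr //; apply: dug_mem.
Qed.

Lemma started_cons s u : started s -> started (u :: s).
Proof. by case/startedP=> v vr sv; apply/startedP; exists v => //; apply: dug_cons. Qed.

Lemma reachable_cons u s : reachable s -> u \in moves s -> reachable (u :: s).
Proof. by case: s => // x s vs us; apply/andP. Qed.

Lemma reachable_ind (Q : seq T -> Prop) : Q [:: root] ->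
  (forall s u, reachable s -> u \in moves s -> Q s -> Q (u :: s)) ->
  forall s, reachable s -> Q s.
Proof.
move=> Q0 Qn; elim=> // u [|x s] IHs; first by move=> /eqP ->.
by move=> /andP[vs us]; apply: Qn => //; apply: IHs.
Qed.

Lemma reachable_head s : reachable s -> head root s \in s.
Proof. by case: s => // u s _; rewrite mem_head. Qed.

Lemma reachable_root s : reachable s -> root \in s.
Proof.
move: s; apply: reachable_ind => [|s u _ _ rs]; first by rewrite mem_head.
by rewrite inE rs orbT.
Qed.

Lemma reachable_dug_root s : reachable s -> dug s root.
Proof. by move=> /reachable_root; rewrite /dug /cookies eqxx -has_pred1 has_count. Qed.

(** The walk first enters a vertex from its parent, and a vertex with cookies left
    only sends the walk upwards, so the parent is dug by then. *)
Lemma reachable_parent s v : reachable s -> v != root -> v \in s -> dug s (parent v).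
Proof.
move=> vs; move: s vs v; apply: reachable_ind => [|s u vs us IHs] v vr.
  by rewrite mem_seq1 (negbTE vr).
rewrite inE => /orP[/eqP e|/IHs H]; last exact/dug_cons/H.
subst v; have xs := reachable_head vs; apply: dug_cons.
have up_dug : head root s != root -> u = parent (head root s) -> dug s (parent u).
  by move=> xr e; apply: (IHs) => //; rewrite e; apply/dug_mem/IHs.
move: us; rewrite /moves; case: ifP => [fx|/negbT nfx].
  by rewrite (mem_nb lf) adjP vr /= => /orP[/andP[xr /eqP /(up_dug xr)]|/eqP <-].
rewrite inE => /eqP; apply: up_dug; apply: contraNneq nfx => ->.
exact: reachable_dug_root.
Qed.

Lemma reachable_anc_dug s u v : reachable s -> v \in s -> anc u v -> u != v -> dug s u.
Proof.
move=> vs; elim/tree_ind: v => [|v vr IHv] vins uv nuv.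
  by move/anc_depth: uv; rewrite depth_root leqn0 depth_eq0 (negbTE nuv).
have fp := reachable_parent vs vr vins.
move: uv; rewrite anc_parent // (negbTE nuv) /= => upv.
by have [->//|npv] := eqVneq u (parent v); apply: IHv => //; apply: dug_mem.
Qed.

Lemma moves_gt0 s : (0 < size (moves s))%N.
Proof. by rewrite /moves; case: ifP => // _; apply: nb_gt0. Qed.

Lemma moves_adj s u : reachable s -> u \in moves s -> adj (head root s) u.
Proof.
move=> vs; rewrite /moves; case: ifP => [_|/negP nf]; first by rewrite (mem_nb lf).
rewrite inE => /eqP ->; apply: adj_parent; apply/eqP => e; apply: nf.
by rewrite e; apply: reachable_dug_root.
Qed.

(** A move upwards leads to a vertex that is dug, by [reachable_parent]. *)
Lemma moves_parent s u : reachable s -> u \in moves s -> u != root -> ~~ dug s u ->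
  parent u = head root s.
Proof.
move=> vs us ur fu; have := moves_adj vs us; rewrite adjP ur /= => /orP[/andP[xr /eqP e]|/eqP -> //].
by case/negP: fu; rewrite e reachable_parent // reachable_head.
Qed.

Lemma reachable_depth s : reachable s -> (depth (head root s) < size s)%N.
Proof.
move: s; apply: reachable_ind => [|s u vs us IHs]; first by rewrite depth_root.
rewrite /= ltnS; apply: leq_trans IHs; apply: depth_adj.
by rewrite adj_sym; apply: moves_adj.
Qed.

Lemma started_nroot s : reachable s -> started s -> alive s -> head root s != root.
Proof.
case: s => // x s vs st /andP[_ al]; apply: contraNneq al => /= xr.
rewrite xr eqxx andbT; move: st; rewrite xr => /startedP [v vr].
by rewrite dug_consN 1?eq_sym // => fv; apply/startedP; exists v.
Qed.

Lemma nstarted_depth s v : reachable s -> ~~ started s -> v \in s -> (depth v <= 1)%N.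
Proof.
move=> vs nst vins; have [->|vr] := eqVneq v root; first by rewrite depth_root.
have fp := reachable_parent vs vr vins.
rewrite (depth_parent vr) ltnS leqn0 depth_eq0; apply: contraNT nst => pr.
by apply/startedP; exists (parent v).
Qed.

Lemma expectS n F s : expect n.+1 F s = step (expect n F) s.
Proof. by []. Qed.

Lemma expectSr n F s : expect n.+1 F s = expect n (step F) s.
Proof. by rewrite /expect iterSr. Qed.

Lemma step_const c s : step (fun=> c) s = c.
Proof.
rewrite /step big_const_seq count_predT iter_addr_0 -(mulr_natr c) mulfK //.
by rewrite pnatr_eq0 -lt0n moves_gt0.
Qed.

Lemma step_le F G s : (forall u, u \in moves s -> F (u :: s) <= G (u :: s)) ->
  step F s <= step G s.
Proof.
move=> FG; rewrite ler_wpM2r ?invr_ge0 //.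
by rewrite big_seq [leRHS]big_seq; apply: ler_sum.
Qed.

Lemma step_eq F G s : (forall u, u \in moves s -> F (u :: s) = G (u :: s)) ->
  step F s = step G s.
Proof. by move=> FG; apply/eqP; rewrite eq_le !step_le // => u /FG ->. Qed.

Lemma stepD F G s : step (fun t => F t + G t) s = step F s + step G s.
Proof. by rewrite /step big_split mulrDl. Qed.

Lemma stepZ c F s : step (fun t => c * F t) s = c * step F s.
Proof. by rewrite /step -mulr_sumr mulrA. Qed.

Lemma expect_le n F G s : reachable s ->
  (forall t, reachable t -> size t = (size s + n)%N -> F t <= G t) ->
  expect n F s <= expect n G s.
Proof.
elim: n s => [|n IHn] s vs FG; first by apply: FG; rewrite ?addn0.
rewrite !expectS; apply: step_le => u us; apply: IHn => [|t vt ts].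
  exact: reachable_cons.
by apply: FG => //; rewrite ts /= addSnnS.
Qed.

Lemma expectD n F G s : expect n (fun t => F t + G t) s = expect n F s + expect n G s.
Proof.
elim: n s => // n IHn s; rewrite !expectS -stepD; apply: step_eq => u _; exact: IHn.
Qed.

Lemma expectZ n c F s : expect n (fun t => c * F t) s = c * expect n F s.
Proof.
elim: n s => // n IHn s; rewrite !expectS -stepZ; apply: step_eq => u _; exact: IHn.
Qed.

Lemma expect_const n c s : expect n (fun=> c) s = c.
Proof. by elim: n s => // n IHn s; rewrite expectS -[RHS](step_const c s); apply: step_eq. Qed.

Lemma expect_sum n (I : Type) (r : seq I) (F : I -> seq T -> R) s :
  expect n (fun t => \sum_(i <- r) F i t) s = \sum_(i <- r) expect n (F i) s.
Proof.
elim: r => [|i r IHr].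
  rewrite big_nil -[RHS](expect_const n 0 s); congr (iter n step _ s).
  by apply/funext => t; rewrite big_nil.
rewrite big_cons -IHr -expectD; congr (iter n step _ s).
by apply/funext => t; rewrite big_cons.
Qed.

Lemma expect_ge0 n F s : reachable s -> (forall t, reachable t -> 0 <= F t) -> 0 <= expect n F s.
Proof.
by move=> vs F0; rewrite -[leLHS](expect_const n 0 s); apply: expect_le => // t vt _; apply: F0.
Qed.

(** A supermartingale has decreasing expectation. The supermartingale inequality is
    only needed where a predicate [Q] holds that the walk preserves, such as
    [started]. *)
Lemma expect_superharmonic (Q : seq T -> Prop) n F s : reachable s -> Q s ->
  (forall t u, reachable t -> Q t -> u \in moves t -> Q (u :: t)) ->
  (forall t, reachable t -> Q t -> step F t <= F t) ->
  expect n F s <= F s.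
Proof.
move=> vs Qs QS stepF; elim: n s vs Qs => [//|n IHn] s vs Qs.
rewrite expectS; apply: le_trans (stepF s vs Qs); apply: step_le => u us.
by apply: IHn; [exact: reachable_cons|exact: QS].
Qed.

Lemma step_ge F s u : (forall t, reachable t -> 0 <= F t) -> reachable s -> u \in moves s ->
  F (u :: s) / (size (moves s))%:R <= step F s.
Proof.
move=> F0 vs us; rewrite ler_wpM2r ?invr_ge0 // (big_rem u) //= lerDl.
rewrite big_seq; apply: sumr_ge0 => y yr; apply/F0/reachable_cons => //.
exact: mem_rem yr.
Qed.

End Walk.

(** * Supermartingales from superharmonic functions *)

Section Potential.
Variable T : rooted_tree.
Hypothesis lf : locally_finite T.
Hypothesis infT : infinite_tree T.
Variable M : nat.
Variable R : realType.
Implicit Types (u v x : T) (s U : seq T) (S : T -> R).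

(** Each cookie eaten at [u] sends the walk from [u] back to [parent u], which changes
    [S u] to [S (parent u)]; this factor keeps track of the ratios lost. The list [U]
    has to contain the vertices of depth at least two where the ratio differs
    from [1]. *)
Definition dig U S s : R :=
  \prod_(u <- U) (S u / S (parent u)) ^+ minn (count_mem u s) M.

(** On a visit that eats a cookie, the walk already counts as sent back. *)
Definition pos s : T :=
  let x := head root s in if dug M s x then x else parent x.

Definition hval U S s : R := (alive M s)%:R * (dig U S s * S (pos s)).

Definition superharmonic S := forall x, x != root ->
  \sum_(u <- nb x) S u <= (size (nb x))%:R * S x.

(** The children of the root are left out of [U]: the ratio [S u / S root] makes no
    sense there, and from the time when [hval] is used the walk cannot visit another
    child of the root before it dies. *)
Record potential U S : Prop := Potential {
  pot_uniq : uniq U ;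
  pot_deep : forall u, u \in U -> u != root /\ parent u != root ;
  pot_const : forall u, u != root -> parent u != root -> u \notin U ->
    S u = S (parent u) ;
  pot_root : S root = 0 ;
  pot_ge0 : forall x, 0 <= S x ;
  pot_sup : superharmonic S }.

Lemma potential_zero U S x u : potential U S -> x != root -> S x = 0 -> adj x u -> S u = 0.
Proof.
move=> pot xr Sx xu; have := pot_sup pot xr; rewrite Sx mulr0 => le0.
apply/eqP; rewrite eq_le (pot_ge0 pot) andbT; apply: le_trans le0.
rewrite (big_rem u) ?(mem_nb lf) //= lerDl.
by apply: sumr_ge0 => y _; apply: (pot_ge0 pot).
Qed.

Lemma dig_ge0 U S s : (forall x, 0 <= S x) -> 0 <= dig U S s.
Proof. by move=> S0; apply: prodr_ge0 => u _; rewrite exprn_ge0 ?divr_ge0. Qed.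

Lemma dig_cons_dug U S s u : (u \in U -> M <= count_mem u s)%N -> dig U S (u :: s) = dig U S s.
Proof.
move=> uM; rewrite /dig big_seq [RHS]big_seq; apply: eq_bigr => y yU /=.
have [e|//] := eqVneq u y; rewrite e in uM *; congr (_ ^+ _).
by have /= := uM yU; rewrite add1n; set k := count _ _; lia.
Qed.

Lemma dig_cons U S s u : uniq U -> u \in U -> (count_mem u s < M)%N ->
  dig U S (u :: s) = dig U S s * (S u / S (parent u)).
Proof.
move=> Uu uU uM; rewrite /dig !(bigD1_seq u) //= eqxx.
rewrite -mulrA [X in _ = _ * X]mulrC mulrA -exprSr; congr (_ ^+ _ * _).
  by rewrite add1n; move: uM; set k := count _ _; lia.
by apply: eq_bigr => y /negbTE; rewrite eq_sym => ->.
Qed.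

(** Whether or not a cookie is eaten at the next vertex [u], the new value is the
    old factor times [S u]: if a cookie is eaten, the additional factor [S u / S x]
    makes up for being sent back to [x = parent u]. Hence [hval] inherits
    (super)harmonicity from [S]. *)
Lemma hval_cons U S s u : potential U S -> reachable M s -> started M s -> alive M s ->
  u \in moves M s -> hval U S (u :: s) = dig U S s * S u.
Proof.
move=> pot vs sts als us; rewrite /hval /= als sts /=.
have [->|ur] /= := eqVneq u root; first by rewrite (pot_root pot) mul0r mulr0.
rewrite mul1r /pos /=; case: ifP => [fu|/negbT nfu].
  congr (_ * _); apply: dig_cons_dug => _.
  by move: fu; rewrite /dug /cookies (negbTE ur) /= eqxx add1n.
have uM : (count_mem u s < M)%N.
  by move: nfu; rewrite /dug /cookies (negbTE ur) /= eqxx add1n -leqNgt.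
have nfs : ~~ dug M s u by apply: contra nfu; apply: dug_cons.
have xr := started_nroot vs sts als.
have e := moves_parent lf vs us ur nfs.
have [Sx|Sx] := eqVneq (S (head root s)) 0.
  by rewrite e Sx (potential_zero pot xr Sx (moves_adj lf vs us)) !mulr0.
have [uU|uU] := boolP (u \in U).
  by rewrite dig_cons ?(pot_uniq pot) // e -mulrA divfK.
by rewrite dig_cons_dug ?(negbTE uU) // -(pot_const pot) // e.
Qed.

Lemma step_hval U S s : potential U S -> reachable M s -> started M s -> alive M s ->
  step M (hval U S) s = dig U S s *
    (if dug M s (head root s) then (\sum_(u <- nb (head root s)) S u) / (size (nb (head root s)))%:R
     else S (parent (head root s))).
Proof.
move=> pot vs sts als; rewrite (step_eq (G := fun t => dig U S s * S (head root t))); last first.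
  by move=> u us; rewrite hval_cons.
rewrite stepZ; congr (_ * _); rewrite /step /moves /=; case: ifP => // _.
by rewrite big_seq1 divr1.
Qed.

Lemma step_hval_dead U S s : ~~ alive M s -> step M (hval U S) s = hval U S s.
Proof.
move=> ds; rewrite {2}/hval (negbTE ds) mul0r -[RHS](step_const lf infT M 0 s).
by apply: step_eq => u us; rewrite /hval /= (negbTE ds) mul0r.
Qed.

Lemma hval_superharmonic U S s : potential U S -> reachable M s -> started M s ->
  step M (hval U S) s <= hval U S s.
Proof.
move=> pot vs sts; have [als|ds] := boolP (alive M s); last by rewrite step_hval_dead.
rewrite step_hval // /hval als mul1r ler_wpM2l ?dig_ge0 //; first exact: (pot_ge0 pot).
rewrite /pos; case: ifP => // _; rewrite ler_pdivrMr ?ltr0n ?(nb_gt0 lf _ infT) // mulrC.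
by apply: (pot_sup pot); apply: (started_nroot vs).
Qed.

Lemma hval_harmonic U S s : potential U S -> reachable M s -> started M s ->
  (head root s != root -> \sum_(u <- nb (head root s)) S u =
    (size (nb (head root s)))%:R * S (head root s)) ->
  step M (hval U S) s = hval U S s.
Proof.
move=> pot vs sts har; have [als|ds] := boolP (alive M s); last by rewrite step_hval_dead.
rewrite step_hval // /hval als mul1r /pos; case: ifP => // _.
rewrite har; last exact: (started_nroot vs).
by rewrite [X in _ * X]mulrC mulKf // pnatr_eq0 -lt0n nb_gt0.
Qed.

Lemma hval_ge0 U S s : (forall x, 0 <= S x) -> 0 <= hval U S s.
Proof. by move=> S0; rewrite !mulr_ge0 ?dig_ge0. Qed.

(** Seen from [x], the function [meetd^~ v] increases by one towards one child and
    decreases by one towards the parent if [x] is a proper ancestor of [v]; it is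
    constant around [x] if [x] is not an ancestor of [v]; at [v] the increasing child
    is missing. *)
Lemma meetd_harmonic x v : x != root ->
  (\sum_(u <- nb x) meetd u v + (x == v) = size (nb x) * meetd x v)%N.
Proof.
move=> xr; rewrite (perm_big _ (perm_nb lf xr)) big_cons (size_nb lf xr) mulSn /=.
have -> : (\sum_(u <- ch x) meetd u v = (anc x v && (x != v)) + size (ch x) * meetd x v)%N.
  rewrite -count_ch_anc // big_seq (eq_bigr (fun u => anc u v + meetd x v)%N).
    rewrite -big_seq big_split /= big_const_seq count_predT iter_addn_0 mulnC.
    congr addn; rewrite -sum1_count.
    by rewrite [RHS]big_mkcond; apply: eq_bigr => u _; case: anc.
  by move=> u; rewrite mem_ch // => /andP[ur /eqP <-]; rewrite meetd_parent.
have := meetd_parent v xr; case: (eqVneq x v) => [->|_].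
  by rewrite anc_refl /=; set k := (size _ * _)%N; lia.
rewrite andbT addn0; set k := (size _ * _)%N; lia.
Qed.

Definition meetS v x : R := (meetd x v)%:R.

Lemma meetS_sum x v : x != root ->
  \sum_(u <- nb x) meetS v u + (x == v)%:R = (size (nb x))%:R * meetS v x.
Proof. by move=> xr; rewrite -natrM -meetd_harmonic // natrD natr_sum. Qed.

Lemma meetS_super v : superharmonic (meetS v).
Proof. by move=> x xr; rewrite -meetS_sum // lerDl. Qed.

Definition branch i v : seq T := [seq up j v | j <- index_iota i (depth v).+1].

Lemma mem_branch i v u : (u \in branch i v) = anc u v && (i <= depth u)%N.
Proof.
apply/mapP/andP => [[j]|[uv iu]].
  by rewrite mem_index_iota ltnS => /andP[ij jv] ->; rewrite anc_up depth_up.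
exists (depth u); last exact: ancP.
by rewrite mem_index_iota iu ltnS anc_depth.
Qed.

Lemma branch_uniq i v : uniq (branch i v).
Proof.
rewrite map_inj_in_uniq ?iota_uniq // => j k.
rewrite !mem_index_iota !ltnS => /andP[_ jv] /andP[_ kv] e.
by rewrite -(depth_up jv) e depth_up.
Qed.

Lemma branch_deep i u v : (1 < i)%N -> u \in branch i v -> u != root /\ parent u != root.
Proof.
move=> i1; rewrite mem_branch => /andP[_ iu].
by rewrite -!depth_eq0 depth_parentE; split; lia.
Qed.

Lemma meetd_const v u : u != root -> ~~ anc u v -> meetd u v = meetd (parent u) v.
Proof. by move=> ur nuv; rewrite meetd_parent // (negbTE nuv). Qed.

Lemma depth_gt1 u : u != root -> parent u != root -> (1 < depth u)%N.
Proof. by rewrite -!depth_eq0 depth_parentE; lia. Qed.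

Lemma branch_potential v : potential (branch 2 v) (meetS v).
Proof.
split; [exact: branch_uniq|by move=> u; apply: branch_deep| |by rewrite /meetS meetd_root|by []|exact: meetS_super].
move=> u ur pr; rewrite mem_branch depth_gt1 // andbT => nuv.
by rewrite /meetS meetd_const.
Qed.

(** The second branch starts below the meet, so that the common ancestors of [v]
    and [v'] are listed once. *)
Lemma pair_potential v v' : (0 < meetd v v')%N ->
  potential (branch 2 v ++ branch (meetd v v').+1 v') (fun x => meetS v x + meetS v' x).
Proof.
move=> b0; split.
- rewrite cat_uniq !branch_uniq andbT /=; apply/hasPn => u /=.
  rewrite !mem_branch => /andP[uv' bu]; apply: contraTN bu => /andP[uv _].
  rewrite -leqNgt leq_meetd !anc_depth //= -(ancP uv erefl) -(ancP uv' erefl).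
  by rewrite eqxx.
- by move=> u; rewrite mem_cat => /orP[]; apply: branch_deep.
- move=> u ur pr; rewrite mem_cat negb_or !mem_branch depth_gt1 // andbT => /andP[nuv].
  rewrite negb_and -leqNgt => nuv'.
  have : ~~ anc u v'.
    case/orP: nuv' => // bu; apply: contra nuv => uv'.
    move: bu; rewrite leq_meetd => /and3P[_ _ /eqP e].
    by rewrite /anc e; exact: uv'.
  by move=> nuv''; rewrite /meetS (meetd_const ur nuv) (meetd_const ur nuv'').
- by rewrite /meetS !meetd_root addr0.
- by move=> x; rewrite addr_ge0.
- by move=> x xr; rewrite big_split mulrDr lerD // meetS_super.
Qed.

End Potential.

Section Products.
Variable R : realType.

Lemma prod_ratio (f : nat -> R) a b : (0 < a <= b)%N -> (forall j, (a <= j.+1)%N -> f j != 0) ->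
  \prod_(a <= j < b) (f j / f j.-1) = f b.-1 / f a.-1.
Proof.
case/andP=> a0 ab f0; rewrite -(subnKC ab); elim: (b - a)%N => [|k IHk].
  by rewrite addn0 big_geq // divff // f0 // prednK.
rewrite addnS big_nat_recr ?leq_addr //= IHk mulrC mulrA divfK //.
by rewrite f0 //; lia.
Qed.

End Products.

(** * Recurrence *)

Section Recurrence.
Variable T : rooted_tree.
Hypothesis lf : locally_finite T.
Hypothesis infT : infinite_tree T.
Variable M : nat.
Variable R : realType.
Implicit Types (u v x : T) (s : seq T).

Lemma dig_fresh U (S : T -> R) s : (forall u, u \in U -> u \notin s) -> dig M U S s = 1.
Proof.
move=> Us; rewrite /dig big_seq big1 // => u /Us us.
by rewrite (count_memPn us) min0n expr0.
Qed.

(** All proper ancestors of [v] are dug when [v] is, so the factors [j / (j - 1)]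
    telescope to [depth v] and occur with exponent [M]; the last factor [depth v] is
    the value of the potential at [v]. This is where the exponent [M + 1] of the
    phase transition comes from. *)
Lemma hval_dug v s : v != root -> reachable M s -> alive M s -> head root s = v ->
  dug M s v -> hval M (branch 2 v) (meetS R v) s = (depth v)%:R ^+ M.+1.
Proof.
move=> vr vs als hs fv; rewrite /hval als mul1r /pos hs fv {2}/meetS meetd_anc ?anc_refl //.
rewrite exprSr; congr (_ * _); rewrite /dig /branch big_map.
have d0 : (0 < depth v)%N by rewrite lt0n depth_eq0.
transitivity ((\prod_(2 <= j < (depth v).+1) (j%:R / j.-1%:R : R)) ^+ M).
  rewrite -prodrXl; apply: eq_big_nat => j /andP[j2 jv].
  have j0 : (0 < j <= depth v)%N by lia.
  rewrite parent_up // /meetS !meetd_anc ?anc_up // !depth_up; [|lia|lia].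
  have fj : dug M s (up j v).
    have [->//|nj] := eqVneq (up j v) v.
    apply: (reachable_anc_dug lf) nj; rewrite ?anc_up //.
    by rewrite -hs; exact: reachable_head vs.
  have jr : up j v != root by rewrite -depth_eq0 depth_up; lia.
  by move: fj; rewrite /dug /cookies (negbTE jr) => fj; rewrite (minn_idPr (ltnW fj)).
rewrite (@prod_ratio _ (fun j => j%:R)) ?divr1 //.
by move=> j j1; rewrite pnatr_eq0; lia.
Qed.

(** A bound for the probability that [v] is dug while the walk is alive: it is at
    least the indicator of this event, and before the first vertex is dug it equals
    the value that [hval], normalized to be [1] at [v], takes when that vertex is the
    right child of the root. *)
Definition exitv v s : R :=
  if ~~ alive M s then 0 else if dug M s v then 1
  else (depth v)%:R ^- M.+1 * (if started M s then hval M (branch 2 v) (meetS R v) s else 1).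

Lemma exitv_ge0 v s : 0 <= exitv v s.
Proof.
rewrite /exitv; case: ifP => // _; case: ifP => // _.
rewrite mulr_ge0 ?invr_ge0 ?exprn_ge0 //; case: ifP => // _.
by apply: hval_ge0 => x; rewrite /meetS.
Qed.

Lemma moves_nstarted s u : reachable M s -> ~~ started M s -> u \in moves M s -> (depth u <= 1)%N.
Proof.
move=> vs nst us; have vus := reachable_cons vs us.
have [->|ur] := eqVneq u root; first by rewrite depth_root.
have := reachable_parent lf vus ur (mem_head _ _).
rewrite dug_consN => [fp|]; last first.
  by apply/eqP => e; move: (depth_parent ur); rewrite -e; lia.
rewrite (depth_parent ur) ltnS leqn0 depth_eq0; apply: contraNT nst => pr.
by apply/startedP; exists (parent u).
Qed.

(** Until the first vertex is dug, only the root and its children have been visited,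
    so the factor [dig] is still [1] and the potential is at most [1]. *)
Lemma exitv_nstarted v s u : v != root -> reachable M s -> alive M s -> ~~ started M s ->
  ~~ dug M s v -> u \in moves M s -> exitv v (u :: s) <= (depth v)%:R ^- M.+1.
Proof.
move=> vr vs als nst nfv us; have vus := reachable_cons vs us.
have du := moves_nstarted vs nst us.
have d0 : (0 < depth v)%N by rewrite lt0n depth_eq0.
have a0 : 0 <= (depth v)%:R ^- M.+1 :> R by rewrite invr_ge0 exprn_ge0.
have young y : y \in u :: s -> (depth y <= 1)%N.
  by rewrite inE => /orP[/eqP->//|]; apply: (nstarted_depth lf vs nst).
rewrite /exitv; case: ifP => // _; case: ifP => [fv|nfv'].
  have dv : depth v = 1%N.
    apply/eqP; rewrite eqn_leq d0 andbT; apply: young; exact: dug_mem fv.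
  by rewrite dv expr1n invr1.
case: ifP => [st|_]; last by rewrite mulr1.
rewrite -[leRHS]mulr1 ler_wpM2l // /hval.
case: (alive M (u :: s)) => //=; last by rewrite mul0r.
rewrite mul1r dig_fresh ?mul1r; last first.
  by move=> y; rewrite mem_branch => /andP[_ dy]; apply/negP => /young; lia.
rewrite /meetS lern1 /pos; set z := if _ then _ else _.
have : (meetd z v <= depth z)%N.
  by have := leqnn (meetd z v); rewrite {1}leq_meetd => /and3P[].
move=> /leq_trans; apply; rewrite /z /=; case: ifP => // _.
by rewrite depth_parentE; lia.
Qed.

Lemma exitv_superharmonic v s : v != root -> reachable M s ->
  step M (exitv v) s <= exitv v s.
Proof.
move=> vr vs; have d0 : (0 < depth v)%N by rewrite lt0n depth_eq0.
have dv0 : (depth v)%:R != 0 :> R by rewrite pnatr_eq0 -lt0n.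
have [als|ds] := boolP (alive M s); last first.
  rewrite {2}/exitv ds -[leRHS](step_const lf infT M 0 s).
  by apply: step_le => u us; rewrite /exitv /= (negbTE ds).
have [fv|nfv] := boolP (dug M s v).
  rewrite {2}/exitv als fv /= -[leRHS](step_const lf infT M 1 s).
  apply: step_le => u us; rewrite /exitv; case: ifP => // _.
  by rewrite dug_cons.
have [st|nst] := boolP (started M s); last first.
  rewrite {2}/exitv als (negbTE nfv) (negbTE nst) /= mulr1.
  rewrite -[leRHS](step_const lf infT M _ s).
  by apply: step_le => u us; apply: exitv_nstarted.
rewrite {2}/exitv als (negbTE nfv) st /=.
have a0 : 0 <= (depth v)%:R ^- M.+1 :> R by rewrite invr_ge0 exprn_ge0.
apply: (@le_trans _ _ (step M (fun t => (depth v)%:R ^- M.+1 *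
    hval M (branch 2 v) (meetS R v) t) s)); last first.
  by rewrite stepZ ler_wpM2l // hval_superharmonic //; exact: branch_potential.
apply: step_le => u us; rewrite /exitv.
case: ifP => [_|/negbFE alus]; first by rewrite mulr_ge0 ?hval_ge0.
case: ifP => [fv|_]; last by rewrite started_cons.
have e : u = v by apply/eqP; apply: contraNT nfv => uv; rewrite -(dug_consN M s uv).
rewrite (@hval_dug v (u :: s)) ?mulVf ?expf_neq0 //.
exact: reachable_cons.
Qed.

Lemma expect_exitv n v : v != root ->
  expect M n (exitv v) [:: root] <= (depth v)%:R ^- M.+1.
Proof.
move=> vr; apply: (@le_trans _ _ (exitv v [:: root])).
  have r0 : reachable M [:: root : T] by rewrite /= eqxx.
  apply: (expect_superharmonic (Q := fun=> True) n r0) => // t vt _.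
  exact: exitv_superharmonic.
have st0 : started M [:: root : T] = false by rewrite /started /= eqxx.
rewrite /exitv st0 /= mulr1; case: ifP => [fv|//].
by have := dug_mem fv; rewrite mem_seq1 (negbTE vr).
Qed.

(** Here [A] is a finite set of vertices that contains the root, [B] lists the children
    of [A] outside [A], and [V] covers both. Bounding the expected time that the walk
    spends [inside] shows that it eventually dies or digs a vertex of [B]. *)
Section Drift.
Variables (A : pred T) (B V : seq T) (D m : nat).
Hypothesis A_root : A root.
Hypothesis A_ch : forall x u, A x -> u \in ch x -> A u \/ u \in B.
Hypothesis B_root : root \notin B.
Hypothesis V_uniq : uniq V.
Hypothesis A_V : forall x, A x -> x \in V.
Hypothesis B_V : forall x, x \in B -> x \in V.
Hypothesis D_gt0 : (0 < D)%N.
Hypothesis D_max : forall x, x \in V -> (size (nb x) <= D)%N.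
Hypothesis m_max : forall x, x \in V -> (depth x <= m)%N.

Definition inside s : bool := alive M s && ~~ has (dug M s) B.

(** A vertex below [B] is out of reach, because its parent chain passes through a
    vertex of [B] that would have to be dug first. *)
Lemma inside_mem s v : reachable M s -> inside s -> v \in s -> A v \/ v \in B.
Proof.
move=> vs /andP[_ ins]; elim/tree_ind: v => [_|v vr IHv vins]; first by left.
have fp := reachable_parent lf vs vr vins.
case: (IHv (dug_mem fp)) => [Ap|pB].
  by apply: (A_ch Ap); rewrite mem_ch // vr eqxx.
by case/hasP: ins; exists (parent v).
Qed.

Lemma inside_V s v : reachable M s -> inside s -> v \in s -> v \in V.
Proof. by move=> vs ins vins; case: (inside_mem vs ins vins) => [/A_V|/B_V]. Qed.

Lemma inside_cons s u : inside (u :: s) -> inside s.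
Proof.
case/andP=> /= /andP[als _] nh; rewrite /inside als; apply: contra nh.
by case/hasP=> v vB fv; apply/hasP; exists v => //; apply: dug_cons.
Qed.

Definition height x : nat := (\sum_(i < depth x) (2 * D) ^ (m - i))%N.

Definition cookies_left s : nat := (\sum_(v <- V) (M.+1 - count_mem v s))%N.

(** One step up lowers [height] by [2 * D] times what one step down adds, so moving up
    with probability at least [1 / D] outweighs all moves down. At the root, which the
    living walk only visits before the first vertex is dug, there is no upward move,
    but the next visit to a child counts as a cookie; the factor of [cookies_left]
    makes this outweigh the step down. *)
Definition drift s : nat :=
  (height (head root s) + ((2 * D) ^ m).+1 * cookies_left s)%N.

Lemma height_step x u : depth u = (depth x).+1 ->
  height u = (height x + (2 * D) ^ (m - depth x))%N.
Proof. by move=> du; rewrite /height du big_ord_recr. Qed.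

Lemma cookies_left_cons s u : (cookies_left (u :: s) <= cookies_left s)%N.
Proof. by apply: leq_sum => v _; rewrite leq_sub2l //= leq_addl. Qed.

Lemma cookies_left_eat s u : u \in V -> (count_mem u s <= M)%N ->
  (cookies_left (u :: s)).+1 = cookies_left s.
Proof.
move=> uV uM; rewrite /cookies_left !(bigD1_seq u) //= eqxx add1n -addSn.
congr addn; first by move: uM; set k := count _ _; lia.
by apply: eq_bigr => v /negbTE vu; rewrite eq_sym vu.
Qed.

Lemma height_parent x : x != root -> (depth x <= m)%N ->
  height x = (height (parent x) + 2 * D * (2 * D) ^ (m - depth x))%N.
Proof.
move=> xr xm; rewrite (height_step (depth_parent xr)) -expnS.
by rewrite (_ : m - depth (parent x) = (m - depth x).+1)%N // depth_parentE; move: xr; rewrite -depth_eq0; lia.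
Qed.

Lemma height_avg x : x != root -> x \in V ->
  (\sum_(u <- nb x) height u + size (nb x) <= size (nb x) * height x)%N.
Proof.
move=> xr xV; rewrite (perm_big _ (perm_nb lf xr)) big_cons /=.
have dx := D_max xV; rewrite (size_nb lf xr) in dx *.
have E1 : (0 < (2 * D) ^ (m - depth x))%N by rewrite expn_gt0 muln_gt0 D_gt0.
rewrite (eq_big_seq (fun=> height x + (2 * D) ^ (m - depth x))%N); last first.
  by move=> u uch; apply/height_step/depth_ch/uch.
rewrite big_const_seq count_predT iter_addn_0 (height_parent xr (m_max xV)).
move: E1 dx; set E := (_ ^ _)%N; set k := size _; nia.
Qed.

Lemma drift_step s : reachable M s -> inside s ->
  step M (fun t => (inside t)%:R * (drift t)%:R) s <= (drift s)%:R - 1 :> R.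
Proof.
move=> vs ins; have xs := reachable_head vs; have xV := inside_V vs ins xs.
have als : alive M s by case/andP: ins.
set x := head root s in xs xV.
apply: (@le_trans _ _ (step M (fun t => (drift t)%:R) s)).
  by apply: step_le => u us; case: inside; rewrite ?mul1r ?mul0r.
have E1 i : (0 < (2 * D) ^ i)%N by rewrite expn_gt0 muln_gt0 D_gt0.
have [xr|xr] := eqVneq x root.
  have nst : ~~ started M s by apply/negP => /(started_nroot vs)/(_ als); rewrite -/x xr eqxx.
  rewrite -[leRHS](step_const lf infT M _ s); apply: step_le => u us.
  have := moves_adj lf vs us; rewrite -/x xr adjP eqxx /= => /andP[ur /eqP e].
  have uV : u \in V.
    by case: (@A_ch root u A_root) => [|/A_V|/B_V] //; rewrite mem_ch // ur -e eqxx.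
  have uM : (count_mem u s <= M)%N.
    rewrite leqNgt; apply: contra nst => fu; apply/startedP; exists u => //.
    by rewrite /dug /cookies (negbTE ur).
  rewrite lerBrDr natr1 ler_nat /drift /= -/x xr.
  rewrite (@height_step root u) ?(depth_parent ur) -?e // depth_root subn0.
  by rewrite -(cookies_left_eat uV uM) mulnS addnA addnS addSn.
have tail u : (((2 * D) ^ m).+1 * cookies_left (u :: s) <= ((2 * D) ^ m).+1 * cookies_left s)%N.
  by rewrite leq_mul2l cookies_left_cons orbT.
have [fx|nfx] := boolP (dug M s x); last first.
  rewrite -[leRHS](step_const lf infT M _ s); apply: step_le => u.
  rewrite /moves -/x (negbTE nfx) inE => /eqP ->.
  rewrite lerBrDr natr1 ler_nat /drift /= -/x.
  rewrite (height_parent xr (m_max xV)) -addnS -addnA leq_add2l -add1n leq_add ?tail //.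
  by rewrite !muln_gt0 D_gt0 E1.
apply: (@le_trans _ _ (step M (fun t => (height (head root t) +
    ((2 * D) ^ m).+1 * cookies_left s)%:R) s)).
  by apply: step_le => u us; rewrite ler_nat /drift leq_add2l tail.
rewrite /step /moves -/x fx ler_pdivrMr ?ltr0n ?(nb_gt0 lf _ infT) //=.
rewrite -natr_sum mulrBl mul1r lerBrDr -natrM -natrD ler_nat big_split /=.
rewrite big_const_seq count_predT iter_addn_0 /drift -/x.
by rewrite mulnDl addnAC leq_add2r (mulnC (height x)) height_avg.
Qed.

(** Each step spent [inside] costs at least one unit of [drift], and [inside] can only
    be left for good, so [n] times the probability to be still [inside] at time [n] is
    at most the initial [drift]. *)
Lemma expect_inside n s : reachable M s ->
  n%:R * expect M n (fun t => (inside t)%:R) s <= (drift s)%:R :> R.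
Proof.
have out k t : reachable M t -> ~~ inside t -> expect M k (fun t => (inside t)%:R) t <= 0 :> R.
  move=> vt out_t; rewrite -[leRHS](_ : (inside t)%:R = 0); last by rewrite (negbTE out_t).
  apply: (expect_superharmonic (Q := fun=> True) k vt) => // y vy _.
  rewrite -[leRHS](step_const lf infT M _ y); apply: step_le => u us.
  by rewrite ler_nat; have := @inside_cons y u; case: inside => // ->.
have le1 k t : reachable M t -> expect M k (fun t => (inside t)%:R) t <= 1 :> R.
  move=> vt; rewrite -[leRHS](expect_const lf infT M k 1 t).
  by apply: expect_le => // y _ _; rewrite lern1 leq_b1.
elim: n s => [|n IHn] s vs; first by rewrite mul0r.
have [ins|nins] := boolP (inside s); last first.
  by apply: (@le_trans _ _ 0) => //; rewrite mulr_ge0_le0 // out.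
rewrite -natr1 mulrDl mul1r.
have -> : (drift s)%:R = (drift s)%:R - 1 + 1 :> R by rewrite subrK.
apply: lerD; last exact: le1.
rewrite expectS -stepZ; apply: le_trans (drift_step vs ins).
apply: step_le => u us; have vus := reachable_cons vs us.
have [insu|ninsu] := boolP (inside (u :: s)); first by rewrite mul1r IHn.
by rewrite mul0r mulr_ge0_le0 // out.
Qed.

(** A living walk is still [inside], or a vertex [v] of [B] is dug while it is alive,
    and then [exitv v] is [1]. *)
Lemma expect_alive n : (0 < n)%N ->
  expect M n (fun t : seq T => (alive M t)%:R) [:: root] <=
    (drift [:: root])%:R / n%:R + \sum_(v <- B) (depth v)%:R ^- M.+1 :> R.
Proof.
move=> n0; have r0 : reachable M [:: root : T] by rewrite /= eqxx.
apply: (@le_trans _ _ (expect M n (fun t => (inside t)%:R + \sum_(v <- B) exitv v t) [:: root])).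
  apply: expect_le => // t vt _; rewrite /inside; case: (boolP (alive M t)) => [alt|_] /=; last first.
    by rewrite add0r sumr_ge0 // => v _; apply: exitv_ge0.
  case: hasP => [[v vB fv]|_] /=; last first.
    by rewrite lerDl sumr_ge0 // => v _; apply: exitv_ge0.
  rewrite add0r (big_rem v) //= {1}/exitv alt fv /= lerDl sumr_ge0 // => y _.
  exact: exitv_ge0.
rewrite expectD; apply: lerD.
  by rewrite ler_pdivlMr ?ltr0n // mulrC expect_inside.
rewrite (expect_sum lf infT) big_seq [leRHS]big_seq; apply: ler_sum => v vB.
by apply: expect_exitv; apply: contraNneq B_root => <-.
Qed.

End Drift.

End Recurrence.

Section Cutset.
Variable T : rooted_tree.
Hypothesis lf : locally_finite T.
Hypothesis infT : infinite_tree T.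
Variable M : nat.
Variable R : realType.
Implicit Types (u v x : T) (s : seq T).
Variable pi : set (T * T).
Hypothesis cut : is_cutset pi.

Definition uncut v := `[< forall w, w != root -> anc w v -> ~ pi (parent w, w) >].

Lemma uncut_root : uncut root.
Proof.
apply/asboolP => w wr /anc_depth; rewrite depth_root leqn0 depth_eq0.
by rewrite (negbTE wr).
Qed.

Lemma uncut_anc u v : anc u v -> uncut v -> uncut u.
Proof.
move=> uv /asboolP Av; apply/asboolP => w wr wu.
by apply: Av => //; apply: anc_trans uv.
Qed.

Lemma uncut_ch x u : uncut x -> u \in ch x -> ~~ uncut u -> pi (x, u).
Proof.
move=> /asboolP Ax; rewrite mem_ch // => /andP[ur /eqP e] /asboolPn nAu.
apply: contrapT => npi; apply: nAu => w wr; rewrite anc_parent // => /orP[/eqP ->|].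
  by rewrite e.
by rewrite e; apply: Ax.
Qed.

(** By Koenig's argument an infinite set of such vertices, being closed under
    ancestors in a locally finite tree, contains a ray; a ray has to cross the
    cutset. *)
Lemma uncut_finite : finite_set [set v | uncut v].
Proof.
apply: contrapT => infA.
pose below v := [set w | uncut w /\ anc v w]%classic.
have /choice [f fP] v : exists u, ~ finite_set (below v) -> u \in ch v /\ ~ finite_set (below u).
  have [[u H]|none] := pselect (exists u, u \in ch v /\ ~ finite_set (below u)).
    by exists u.
  exists v => infv; exfalso; apply: infv.
  apply: (@sub_finite_set _ _ ([set v] `|` \bigcup_(u in [set` ch v]) below u)%classic).
    move=> w [Aw vw] /=; have [->|nwv] := eqVneq w v; [by left|right].
    have : has (fun u => anc u w) (ch v).
      by rewrite has_count count_ch_anc // vw eq_sym nwv.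
    by case/hasP => u uch uw; exists u.
  rewrite finite_setU; split; first exact: finite_set1.
  apply: bigcup_finite; first exact: finite_seq.
  by move=> u /= uch; apply: contrapT => nf; apply: none; exists u.
pose nu i := iter i f (root : T).
have inf_nu i : ~ finite_set (below (nu i)).
  elim: i => [|i IHi] /=; last by case: (fP _ IHi).
  apply: contra_not infA; apply: sub_finite_set => v Av; split=> //; exact: anc_root.
have ch_nu i : nu i.+1 \in ch (nu i) by case: (fP _ (inf_nu i)).
have d_nu i : depth (nu i) = i.
  by elim: i => [|i IHi]; [exact: depth_root|rewrite (depth_ch lf (ch_nu i)) IHi].
have ray : infinite_path_from_root nu.
  split=> // [i|i j e]; last by rewrite -(d_nu i) e d_nu.
  by move: (ch_nu i); rewrite mem_filter mem_nb // => /andP[].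
have [_ /(_ nu ray) [[|i] [[// _ pi_i] _]]] := cut.
have {}pi_i : pi (nu i, nu i.+1).
  by have : pi (edge (nu i) (nu i.+1)) := pi_i; rewrite /edge !d_nu ltnSn.
have : (below (nu i.+1) !=set0)%classic.
  by apply/set0P/eqP => e; apply: (inf_nu i.+1); rewrite e.
case=> w [Aw nw]; have /asboolP An := uncut_anc nw Aw.
have := ch_nu i; rewrite mem_ch // => /andP[nr /eqP e].
by apply: (An _ nr (anc_refl _)); rewrite e.
Qed.

Definition uncut_seq : seq T := finmap.enum_fset (fset_set [set v | uncut v]%classic).

Lemma mem_uncut_seq v : (v \in uncut_seq) = uncut v.
Proof.
rewrite /uncut_seq (in_fset_set uncut_finite).
by apply/idP/idP; rewrite in_setE.
Qed.

Definition cut_boundary : seq T :=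
  undup [seq u <- flatten [seq ch x | x <- uncut_seq] | ~~ uncut u].

Lemma mem_cut_boundary u : reflect (exists2 x, uncut x & u \in ch x /\ ~~ uncut u) (u \in cut_boundary).
Proof.
rewrite mem_undup mem_filter; apply: (iffP andP) => [[nu /flattenP [_ /mapP[x xA ->] ux]]|].
  by exists x; [rewrite -mem_uncut_seq|].
case=> x xA [ux nu]; split=> //; apply/flattenP; exists (ch x) => //.
by apply/mapP; exists x; rewrite ?mem_uncut_seq.
Qed.

Lemma sum_boundary_le :
  ((\sum_(v <- cut_boundary) (depth v)%:R ^- M.+1 : R)%:E <= cutset_sum (M%:R + 1) pi)%E.
Proof.
pose r := [seq (parent v, v) | v <- cut_boundary].
apply: esum_ge; exists [set` r]%classic.
  split; first exact: finite_seq.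
  move=> _ /= /mapP[v /mem_cut_boundary [x xA [vx nv]] ->].
  have := vx; rewrite mem_ch // => /andP[vr /eqP e]; rewrite e.
  exact: uncut_ch xA vx nv.
rewrite -fsbig_seq /=; last by rewrite map_inj_uniq ?undup_uniq // => u v [].
rewrite big_map -sumEFin; apply: lee_sum => v _.
by rewrite /edge_depth /= natr1 powRN powR_mulrn.
Qed.

Lemma expect_alive_cutset : exists C : R, forall n, (0 < n)%N ->
  ((expect M n (fun t : seq T => (alive M t)%:R) [:: root] - C / n%:R)%:E
    <= cutset_sum (M%:R + 1) pi)%E.
Proof.
pose V := undup (uncut_seq ++ cut_boundary).
have leV (F : T -> nat) x : x \in V -> (F x <= \sum_(v <- V) F v)%N.
  by move=> xV; rewrite (big_rem x) //= leq_addr.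
have A_ch x u : uncut x -> u \in ch x -> uncut u \/ u \in cut_boundary.
  move=> Ax ux; have [|nu] := boolP (uncut u); [by left|right].
  by apply/mem_cut_boundary; exists x.
have B_root : root \notin cut_boundary.
  by apply/negP => /mem_cut_boundary [x _ []]; rewrite uncut_root.
have A_V x : uncut x -> x \in V.
  by move=> Ax; rewrite mem_undup mem_cat mem_uncut_seq Ax.
have B_V x : x \in cut_boundary -> x \in V.
  by move=> Bx; rewrite mem_undup mem_cat Bx orbT.
have D_max x : x \in V -> (size (nb x) <= (\sum_(v <- V) size (nb v)).+1)%N.
  by move=> xV; rewrite leqW // (leV (fun v => size (nb v))).
eexists => n n0.
have := @expect_alive _ lf infT M R uncut _ V _ _ uncut_root A_ch B_root (undup_uniq _)
   A_V B_V (ltn0Sn _) D_max (leV (@depth T)) n n0.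
rewrite -lerBlDl -lee_fin => /le_trans; apply.
exact: sum_boundary_le.
Qed.

End Cutset.

(** * Flows and cutsets *)

Section Rays.
Variable T : rooted_tree.
Implicit Types (x : T) (nu : nat -> T).

Lemma ray_parent nu i : infinite_path_from_root nu ->
  nu i.+1 != root /\ parent (nu i.+1) = nu i.
Proof.
case=> nu0 nuadj nuinj; elim: i => [|i [nr pi]].
  by have := nuadj 0%N; rewrite nu0 adjP eqxx /= => /andP[-> /eqP ->].
have := nuadj i.+1; rewrite adjP nr /= => /orP[/eqP e|/andP[-> /eqP ->]//].
by rewrite pi in e; have := nuinj _ _ e; lia.
Qed.

Lemma ray_depth nu i : infinite_path_from_root nu -> depth (nu i) = i.
Proof.
move=> ray; elim: i => [|i IHi]; first by case: ray => -> _ _; exact: depth_root.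
by have [nr e] := ray_parent i ray; rewrite (depth_parent nr) e IHi.
Qed.

Lemma ray_anc nu x i : infinite_path_from_root nu -> anc x (nu i) -> x = nu (depth x).
Proof.
move=> ray; elim: i => [|i IHi].
  move=> xi; have := anc_depth xi; rewrite (ray_depth 0 ray) leqn0 => /eqP d0.
  by rewrite d0 -(anc_eq xi) // (ray_depth 0 ray) d0.
have [nr e] := ray_parent i ray; rewrite anc_parent // => /orP[/eqP ->|].
  by rewrite ray_depth.
by rewrite e.
Qed.

Lemma ray_edge nu i : infinite_path_from_root nu ->
  edge (nu i) (nu i.+1) = (parent (nu i.+1), nu i.+1).
Proof. by move=> ray; rewrite /edge !ray_depth // ltnSn; case: (ray_parent i ray) => _ ->. Qed.

End Rays.

Section Flow.
Variable T : rooted_tree.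
Hypothesis lf : locally_finite T.
Variable R : realType.
Variable cap : nat -> R.
Hypothesis cap_ge0 : forall k, 0 <= cap k.
Implicit Types (u v x c : T) (r : nat) (nu : nat -> T).

(** The largest flow from [x] to its descendants [r] levels below, when an edge into
    depth [k] has capacity [cap k]; [mincut] is a cut of this value. *)
Fixpoint maxflow r x : R :=
  if r is r'.+1 then Num.min (cap (depth x)) (\sum_(u <- ch x) maxflow r' u)
  else cap (depth x).

Fixpoint mincut r x : seq T :=
  if r is r'.+1 then
    if cap (depth x) <= \sum_(u <- ch x) maxflow r' u then [:: x]
    else flatten [seq mincut r' u | u <- ch x]
  else [:: x].

Lemma sum_flatten (F : T -> R) (f : T -> seq T) (s : seq T) :
  \sum_(u <- flatten [seq f x | x <- s]) F u = \sum_(x <- s) \sum_(u <- f x) F u.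
Proof. by rewrite big_flatten big_map. Qed.

Lemma mincut_sum r x : \sum_(u <- mincut r x) cap (depth u) = maxflow r x.
Proof.
elim: r x => [|r IHr] x /=; first by rewrite big_seq1.
case: (lerP (cap (depth x))) => _; first by rewrite big_seq1.
by rewrite sum_flatten; apply: eq_bigr => u _; apply: IHr.
Qed.

Lemma mincut_anc r x u : u \in mincut r x -> anc x u.
Proof.
elim: r x => [|r IHr] x /=; first by rewrite inE => /eqP ->; exact: anc_refl.
case: ifP => _; first by rewrite inE => /eqP ->; exact: anc_refl.
case/flattenP => _ /mapP[y + ->] /IHr yu; rewrite mem_ch // => /andP[_ /eqP <-].
exact: anc_trans (anc_parentl y) yu.
Qed.

Lemma ray_ch nu i : infinite_path_from_root nu -> nu i.+1 \in ch (nu i).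
Proof. by move=> ray; rewrite mem_ch //; case: (ray_parent i ray) => -> ->; rewrite eqxx. Qed.

Lemma mincut_children nu i j r : infinite_path_from_root nu ->
  nu j \in flatten [seq mincut r u | u <- ch (nu i)] -> nu j \in mincut r (nu i.+1).
Proof.
move=> ray /flattenP [_ /mapP[y ych ->]] yj.
have := ray_anc ray (mincut_anc yj); rewrite (depth_ch lf ych) ray_depth // => e.
by rewrite -e.
Qed.

Lemma mincut_ray nu i r : infinite_path_from_root nu ->
  exists! j, nu j \in mincut r (nu i).
Proof.
move=> ray; have [_ _ nuinj] := ray.
have single k : exists! j, nu j \in [:: nu k].
  by exists k; split=> [|j]; rewrite inE ?eqxx // => /eqP /nuinj.
elim: r i => [|r IHr] i /=; first exact: single.
case: ifP => _; first exact: single.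
have [j [jin juniq]] := IHr i.+1; exists j; split.
  by apply/flattenP; exists (mincut r (nu i.+1)) => //; apply/map_f/ray_ch.
by move=> k /(mincut_children ray)/juniq.
Qed.

Definition root_cut r : seq T := flatten [seq mincut r u | u <- ch (@Defs.root T)].

Definition root_cut_edges r : set (T * T) :=
  [set` [seq (parent u, u) | u <- root_cut r]]%classic.

(** A ray follows one child at each vertex, so it meets the recursively chosen cut of
    the subtree below its current vertex exactly once. *)
Lemma root_cutset r : is_cutset (root_cut_edges r).
Proof.
split=> [_ /mapP[u uin ->]|nu ray].
  have ur : u != root.
    case/flattenP: uin => _ /mapP[y ych ->] /mincut_anc/anc_depth.
    by rewrite (depth_ch lf ych) -depth_eq0; lia.
  by split=> /=; [rewrite adj_sym adj_parent|exact: depth_parent].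
have [j [jin juniq]] := mincut_ray 1 r ray.
have nu0 : nu 0%N = root by case: ray.
have mem_cut k : nu k \in root_cut r -> nu k \in mincut r (nu 1%N).
  by rewrite /root_cut -nu0; apply: mincut_children.
have dj : (1 <= j)%N by have := anc_depth (mincut_anc jin); rewrite !ray_depth.
exists j; split.
  split=> //; case: j jin dj {juniq} => // j jin _; rewrite /= ray_edge //.
  apply: map_f; apply/flattenP; exists (mincut r (nu 1%N)) => //.
  by rewrite -nu0; apply/map_f/ray_ch.
move=> [|k] [//] _; rewrite /= ray_edge // => /mapP[u uin [_ e]].
by apply: juniq; apply: mem_cut; rewrite e.
Qed.

Lemma sum_undup_le (I : eqType) (s : seq I) (F : I -> R) : (forall i, 0 <= F i) ->
  \sum_(i <- undup s) F i <= \sum_(i <- s) F i.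
Proof.
move=> F0; elim: s => //= i s IHs; case: ifP => _; rewrite !big_cons ?lerD2l //.
by apply: le_trans IHs _; rewrite lerDr.
Qed.

Lemma root_cut_sum r g : (forall k, cap k = k%:R `^ (- g)) ->
  (cutset_sum g (root_cut_edges r) <= (\sum_(c <- ch (@Defs.root T)) maxflow r c)%:E)%E.
Proof.
move=> capE; rewrite /cutset_sum.
have -> : root_cut_edges r = [set` undup [seq (parent u, u) | u <- root_cut r]]%classic.
  by apply/seteqP; split=> e /=; rewrite mem_undup.
rewrite esum_fset; [|exact: finite_seq|move=> e _; rewrite lee_fin; exact: powR_ge0].
rewrite -fsbig_seq ?undup_uniq //= sumEFin lee_fin.
apply: le_trans (sum_undup_le _ _) _; first by move=> e; exact: powR_ge0.
rewrite big_map; under eq_bigr do rewrite /edge_depth /= -capE.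
by rewrite /root_cut sum_flatten; apply: ler_sum => c _; rewrite mincut_sum.
Qed.

Lemma maxflow_ge0 r x : 0 <= maxflow r x.
Proof.
elim: r x => [|r IHr] x //=; rewrite le_min cap_ge0 sumr_ge0 //.
Qed.

Lemma maxflow_cap r x : maxflow r x <= cap (depth x).
Proof. by case: r => [|r] //=; rewrite ge_min lexx. Qed.

Fixpoint level c j : seq T :=
  if j is j'.+1 then flatten [seq ch y | y <- level c j'] else [:: c].

Lemma level_depth c j v : v \in level c j -> depth v = (depth c + j)%N.
Proof.
elim: j v => [|j IHj] v /=; first by rewrite inE addn0 => /eqP ->.
by case/flattenP => _ /mapP[y /IHj dy ->] /(depth_ch lf) ->; rewrite dy addnS.
Qed.

Lemma level_anc c j v : v \in level c j -> anc c v.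
Proof.
elim: j v => [|j IHj] v /=; first by rewrite inE => /eqP ->; exact: anc_refl.
case/flattenP => _ /mapP[y /IHj cy ->]; rewrite mem_ch // => /andP[_ /eqP e].
by rewrite -e in cy; exact: anc_trans cy (anc_parentl v).
Qed.

(** A flow of maximal value through [c], distributed from the top: the flow into a
    vertex is split among its children in proportion to their [maxflow]. *)
Fixpoint flow c r j x : R :=
  if j is j'.+1 then
    flow c r j' (parent x) * maxflow (r - j) x /
      \sum_(u <- ch (parent x)) maxflow (r - j) u
  else maxflow r c.

Lemma flow_bound c r j x : (j <= r)%N -> x \in level c j ->
  0 <= flow c r j x <= maxflow (r - j) x.
Proof.
elim: j x => [|j IHj] x jr /=.
  by rewrite inE => /eqP ->; rewrite subn0 maxflow_ge0 lexx.
case/flattenP => _ /mapP[y /(IHj y (ltnW jr)) /andP[y0 yF] ->].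
rewrite mem_ch // => /andP[xr /eqP e]; rewrite e.
have s0 : 0 <= \sum_(u <- ch y) maxflow (r - j.+1) u by rewrite sumr_ge0 // => u _; apply: maxflow_ge0.
rewrite divr_ge0 ?mulr_ge0 ?maxflow_ge0 //=.
move: yF; rewrite (_ : r - j = (r - j.+1).+1)%N; last lia.
rewrite /= le_min => /andP[_ ys].
have [->|sn0] := eqVneq (\sum_(u <- ch y) maxflow (r - j.+1) u) 0.
  by rewrite invr0 mulr0 maxflow_ge0.
rewrite ler_pdivrMr ?lt0r ?sn0 // mulrC ler_wpM2l ?maxflow_ge0 //.
Qed.

Lemma flow_conserved c r j y : (j < r)%N -> y \in level c j ->
  \sum_(u <- ch y) flow c r j.+1 u = flow c r j y.
Proof.
move=> jr yl; have /andP[y0] := flow_bound (ltnW jr) yl.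
rewrite (_ : r - j = (r - j.+1).+1)%N; last lia.
rewrite /= le_min => /andP[_ ys].
transitivity (\sum_(u <- ch y) flow c r j y * maxflow (r - j.+1) u /
    \sum_(w <- ch y) maxflow (r - j.+1) w).
  rewrite big_seq [RHS]big_seq; apply: eq_bigr => u.
  by rewrite mem_ch // => /andP[_ /eqP ->].
rewrite -mulr_suml -mulr_sumr.
have [s0|sn0] := eqVneq (\sum_(u <- ch y) maxflow (r - j.+1) u) 0; last by rewrite mulfK.
by rewrite s0 mulr0 mul0r; apply/eqP; rewrite eq_le y0 -s0 ys.
Qed.

End Flow.

Section Energy.
Variable T : rooted_tree.
Hypothesis lf : locally_finite T.
Variable R : realType.
Variable cap : nat -> R.
Variables (c : T) (r : nat) (th : nat -> T -> R) (G : nat -> R).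
Hypothesis th_bound : forall j x, (j <= r)%N -> x \in level c j -> 0 <= th j x <= cap (depth x).
Hypothesis th_conserved : forall j y, (j < r)%N -> y \in level c j ->
  \sum_(u <- ch y) th j.+1 u = th j y.
Hypothesis G_mono : forall k, G k <= G k.+1.
Hypothesis c_depth : depth c = 1%N.
Implicit Types (u v x : T).

Lemma level_uniq j : uniq (level c j).
Proof.
elim: j => //= j; move: (level c j) => s; elim: s => //= y s IHs /andP[ys us].
rewrite cat_uniq ch_uniq IHs // andbT /=; apply/hasPn => u /flattenP [_ /mapP[z zs ->]].
rewrite !mem_ch // => /andP[-> /eqP e] /=; apply: contra ys => /eqP <-.
by rewrite e.
Qed.

Lemma th_total j : (j <= r)%N -> \sum_(v <- level c j) th j v = th 0 c.
Proof.
elim: j => [|j IHj] jr; first by rewrite big_seq1.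
rewrite [level _ _]/= sum_flatten -(IHj (ltnW jr)) big_seq [RHS]big_seq.
by apply: eq_bigr => y yl; rewrite th_conserved.
Qed.

(** The second moment of the flow under a kernel that depends on the branching
    depth of a pair only. *)
Definition energy j : R :=
  \sum_(v <- level c j) \sum_(v' <- level c j) th j v * th j v' * G (meetd v v').

(** Two distinct vertices of one level meet where their parents meet, and the flow is
    conserved, so passing to the next level only changes the diagonal terms. *)
Lemma energyS j : (j < r)%N -> energy j.+1 =
  energy j + (G j.+2 - G j.+1) * \sum_(v <- level c j.+1) th j.+1 v ^+ 2.
Proof.
move=> jr; have meetE v v' : v \in level c j.+1 -> v' \in level c j.+1 ->
    G (meetd v v') = G (meetd (parent v) (parent v')) + (v == v')%:R * (G j.+2 - G j.+1).
  move=> vl vl'; have dv := level_depth lf vl; have dv' := level_depth lf vl'.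
  have vr : v != root by rewrite -depth_eq0 dv c_depth; lia.
  have vr' : v' != root by rewrite -depth_eq0 dv' c_depth; lia.
  have anc_vv' : anc v v' = (v == v').
    apply/idP/eqP => [a|->]; last exact: anc_refl.
    by apply: anc_eq; rewrite // dv dv'.
  have par_ne : v != v' -> meetd v v' = meetd (parent v) (parent v').
    move=> nvv'; rewrite meetd_parent // anc_vv' (negbTE nvv') add0n.
    rewrite meetdC meetd_parent // meetdC.
    suff -> : anc v' (parent v) = false by [].
    apply/negP => /anc_depth; rewrite depth_parentE dv dv' c_depth; lia.
  have [e|/par_ne ->] := eqVneq v v'; last by rewrite mul0r addr0.
  rewrite -e !meetd_anc ?anc_refl // depth_parentE dv c_depth mul1r.
  by rewrite [in RHS]addrC subrK.
rewrite {1}/energy.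
transitivity (\sum_(v <- level c j.+1) \sum_(v' <- level c j.+1)
    (th j.+1 v * th j.+1 v' * G (meetd (parent v) (parent v')) +
     (G j.+2 - G j.+1) * ((v == v')%:R * (th j.+1 v * th j.+1 v')))).
  rewrite big_seq [RHS]big_seq; apply: eq_bigr => v vl.
  rewrite big_seq [RHS]big_seq; apply: eq_bigr => v' vl'.
  rewrite meetE //; ring.
under eq_bigr do rewrite big_split /=.
rewrite big_split /=; congr (_ + _).
  rewrite sum_flatten /energy big_seq [RHS]big_seq; apply: eq_bigr => y yl.
  transitivity (\sum_(v <- ch y) \sum_(y' <- level c j) th j.+1 v * th j y' * G (meetd y y')).
    rewrite big_seq [RHS]big_seq; apply: eq_bigr => v vy.
    rewrite sum_flatten big_seq [RHS]big_seq; apply: eq_bigr => y' yl'.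
    rewrite -(th_conserved jr yl') mulr_sumr mulr_suml big_seq [RHS]big_seq.
    apply: eq_bigr => v' vy'; move: vy vy'; rewrite !mem_ch // => /andP[_ /eqP ->] /andP[_ /eqP ->].
    by [].
  rewrite exchange_big /=; apply: eq_bigr => y' _.
  by rewrite -(th_conserved jr yl) !mulr_suml.
under eq_bigr do rewrite -mulr_sumr.
rewrite -mulr_sumr; congr (_ * _); rewrite big_seq [RHS]big_seq; apply: eq_bigr => v vl.
rewrite (bigD1_seq v) ?(level_uniq j.+1) //=.
rewrite eqxx mul1r big1 ?addr0 ?expr2 // => v' nv.
by rewrite eq_sym (negbTE nv) mul0r.
Qed.

Lemma energy_le : G 0 = 0 -> (forall k, 0 <= cap k) ->
  energy r <= th 0 c * \sum_(1 <= k < r.+2) (G k - G k.-1) * cap k.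
Proof.
move=> G0 cap0.
have thc := th_bound (leq0n r) (mem_head _ _); case/andP: thc => thc0 thc1.
suff H j : (j <= r)%N -> energy j <= th 0 c * \sum_(1 <= k < j.+2) (G k - G k.-1) * cap k.
  exact: H.
elim: j => [_|j IHj jr].
  rewrite /energy big_nat1 !big_seq1 meetd_anc ?anc_refl // c_depth /= G0 subr0 -mulrA.
  rewrite [G 1 * _]mulrC ler_wpM2l // ler_wpM2r ?(le_trans _ thc1) //.
    by rewrite -G0.
  by rewrite -c_depth.
rewrite energyS // [in leRHS]big_nat_recr //= mulrDr lerD ?IHj 1?ltnW //.
rewrite mulrCA ler_wpM2l ?subr_ge0 //.
rewrite -(th_total jr) mulr_suml big_seq [leRHS]big_seq; apply: ler_sum => v vl.
have /andP[v0 vcap] := th_bound jr vl.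
rewrite expr2 ler_wpM2l //; apply: le_trans vcap _.
by rewrite (@level_depth _ lf c j.+1 v vl) c_depth add1n.
Qed.

End Energy.

(** * Quasi-independence of two branches *)

Section SecondMoment.
Variable T : rooted_tree.
Hypothesis lf : locally_finite T.
Hypothesis infT : infinite_tree T.
Variable M : nat.
Variable R : realType.
Implicit Types (u v x c : T) (s t : seq T).

Lemma expect_harmonic n (F : seq T -> R) s K : reachable M s -> started M s -> (size s + n <= K)%N ->
  (forall t, reachable M t -> started M t -> (size t < K)%N -> step M F t = F t) ->
  expect M n F s = F s.
Proof.
move=> + + + har; elim: n s => // n IHn s vs st sK.
rewrite expectS -(har s vs st); last by lia.
apply: step_eq => u us; apply: IHn; [exact: reachable_cons|exact: started_cons|].
by rewrite /= addSnnS.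
Qed.

Lemma expect_hval v n s : reachable M s -> started M s -> (size s + n <= depth v)%N ->
  expect M n (hval M (branch 2 v) (meetS R v)) s = hval M (branch 2 v) (meetS R v) s.
Proof.
move=> vs st sn; apply: (expect_harmonic vs st sn) => t vt stt tv.
apply: hval_harmonic => //; first exact: branch_potential.
move=> xr; rewrite -meetS_sum // (_ : (head root t == v) = false) ?addr0 //.
apply/negbTE; apply: contraTneq tv => <-; rewrite -leqNgt ltnW //.
exact: (reachable_depth lf vt).
Qed.

Lemma prod_pow_le (q : nat -> R) (m : nat -> nat) a b :
  (forall j, (a <= j < b)%N -> 1 <= q j /\ (m j <= M)%N) ->
  \prod_(a <= j < b) q j ^+ m j <= (\prod_(a <= j < b) q j) ^+ M.
Proof.
move=> qm; rewrite -prodrXl big_nat [leRHS]big_nat; apply: ler_prod => j /qm [q1 mM].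
by rewrite exprn_ge0 ?(le_trans ler01) //= ler_weXn2l.
Qed.

(** [sg] lists the values of [meetS v + meetS v'] along the way to [v], where [b] is
    the depth at which the ways to [v] and [v'] part. *)
Definition sg b j : R := (j + minn j b)%:R.

(** The quotient [j / sg b j] is nondecreasing in [j] and stays between [1 / 2] and [1], so
    exchanging the factors of one branch costs at most [2 ^+ M]. *)
Lemma prod_sg (m : nat -> nat) a b K : (0 < b)%N -> (1 < a)%N -> (forall j, (m j <= M)%N) ->
  \prod_(a <= j < K) (j%:R / j.-1%:R) ^+ m j <=
    2 ^+ M * \prod_(a <= j < K) (sg b j / sg b j.-1) ^+ m j.
Proof.
move=> b0 a1 mM.
have sg_gt0 j : (0 < j)%N -> 0 < sg b j by move=> j0; rewrite ltr0n; lia.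
have [Ka|aK] := leqP K a; first by rewrite !big_geq // mulr1 exprn_ege1 // ler1n.
pose rho j : R := j%:R / sg b j.
have E : \prod_(a <= j < K) (j%:R / j.-1%:R) ^+ m j =
    (\prod_(a <= j < K) (rho j / rho j.-1) ^+ m j) * \prod_(a <= j < K) (sg b j / sg b j.-1) ^+ m j :> R.
  rewrite -big_split /= big_nat [RHS]big_nat; apply: eq_bigr => j /andP[aj jK].
  rewrite -exprMn; congr (_ ^+ _); rewrite /rho.
  have n0 : j.-1%:R != 0 :> R by rewrite pnatr_eq0; lia.
  have := lt0r_neq0 (sg_gt0 j ltac:(lia)); have := lt0r_neq0 (sg_gt0 j.-1 ltac:(lia)).
  by move=> h1 h2; field; rewrite -!natrD; apply/and3P.
rewrite E ler_wpM2r //.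
  by rewrite prodr_ge0 // => j _; rewrite exprn_ge0 // divr_ge0 // ler0n.
apply: le_trans (prod_pow_le _) _.
  move=> j /andP[aj jK]; split=> //; rewrite /rho.
  have j1 : 0 < j.-1%:R :> R by rewrite ltr0n; lia.
  have s0 := sg_gt0 j ltac:(lia); have s1 := sg_gt0 j.-1 ltac:(lia).
  rewrite ler_pdivlMr ?divr_gt0 // mul1r ler_pdivrMr // mulrAC ler_pdivlMr //.
  by rewrite /sg -!natrM ler_nat; nia.
rewrite lerXn2r ?nnegrE //.
  by rewrite prodr_ge0 // => j _; rewrite !divr_ge0 // ler0n.
rewrite prod_ratio; last 2 first.
- by lia.
- move=> j aj; rewrite mulf_neq0 ?invr_neq0 ?pnatr_eq0 //; lia.
have s0 := sg_gt0 K.-1 ltac:(lia); have s1 := sg_gt0 a.-1 ltac:(lia).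
have a0 : 0 < a.-1%:R :> R by rewrite ltr0n; lia.
have r1 : rho K.-1 <= 1 by rewrite /rho ler_pdivrMr // mul1r ler_nat leq_addr.
have r2 : 1 <= 2 * rho a.-1.
  by rewrite /rho mulrA ler_pdivlMr // mul1r -natrM ler_nat; lia.
by rewrite ler_pdivrMr ?divr_gt0 //; apply: le_trans r2.
Qed.

Lemma dig_branch v s : dig M (branch 2 v) (meetS R v) s =
  \prod_(2 <= j < (depth v).+1) (j%:R / j.-1%:R) ^+ minn (count_mem (up j v) s) M.
Proof.
rewrite /dig /branch big_map; apply: eq_big_nat => j /andP[j2 jv].
by rewrite parent_up ?/meetS ?meetd_anc ?anc_up ?depth_up //; lia.
Qed.

Lemma meetS_pair_up j v v' : (j <= depth v)%N ->
  meetS R v (up j v) + meetS R v' (up j v) = sg (meetd v v') j.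
Proof.
by move=> jv; rewrite /meetS meetd_anc ?anc_up // depth_up // meetd_up // meetdC /sg natrD.
Qed.

Lemma dig_pair v v' s : (0 < meetd v v')%N ->
  dig M (branch 2 v ++ branch (meetd v v').+1 v') (fun x => meetS R v x + meetS R v' x) s =
  (\prod_(2 <= j < (depth v).+1) (sg (meetd v v') j / sg (meetd v v') j.-1) ^+ minn (count_mem (up j v) s) M) *
  \prod_((meetd v v').+1 <= j < (depth v').+1) (sg (meetd v v') j / sg (meetd v v') j.-1) ^+ minn (count_mem (up j v') s) M.
Proof.
move=> b0; rewrite /dig /branch big_cat !big_map /=; congr (_ * _).
  apply: eq_big_nat => j /andP[j2 jv].
  by rewrite parent_up ?meetS_pair_up //; lia.
apply: eq_big_nat => j /andP[j2 jv].
have comm x : meetS R v x + meetS R v' x = meetS R v' x + meetS R v x by rewrite addrC.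
by rewrite parent_up ?comm ?(meetS_pair_up v) ?(meetdC v') //; lia.
Qed.

(** The product on the left is not a supermartingale, because both factors move
    together on the common stem. To dominate it by one, let the two branches fail
    independently, each at half the rate at which the walk really returns from the
    meet to the root: the time until one of them fails has the true law, so that both
    branches succeed at least as often. Halving a rate means doubling the length of the
    stem, and this leads to the potential [meetS v + meetS v']. The stem then counts
    once instead of twice, whence the power of [meetd v v']; the changed lengths cost
    at most [2 ^+ M] for each branch. *)
Lemma hval_pair v v' s : (0 < meetd v v')%N ->
  hval M (branch 2 v) (meetS R v) s * hval M (branch 2 v') (meetS R v') s <=
  4 ^+ M * (meetd v v')%:R ^+ M.+1 *
    hval M (branch 2 v ++ branch (meetd v v').+1 v') (fun x => meetS R v x + meetS R v' x) s.
Proof.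
move=> b0; rewrite /hval; case: (alive M s); last by rewrite !mul0r !mulr0.
rewrite !mul1r; set b := meetd v v' in b0 *; set x := pos M s.
have bv : (b <= depth v)%N by have := leqnn b; rewrite {2}/b leq_meetd => /and3P[].
have bv' : (b <= depth v')%N by have := leqnn b; rewrite {2}/b leq_meetd => /and3P[].
have upE j : (j <= b)%N -> up j v' = up j v.
  by rewrite leq_meetd => /and3P[_ _ /eqP ->].
pose D := dig M (branch 2 v ++ branch b.+1 v') (fun x => meetS R v x + meetS R v' x) s.
have digs : dig M (branch 2 v) (meetS R v) s * dig M (branch 2 v') (meetS R v') s <=
    4 ^+ M * b%:R ^+ M * D.
  rewrite /D dig_pair // -/b !dig_branch.
  pose m u := minn (count_mem u s) M.
  have mM u : (m u <= M)%N by exact: geq_minr.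
  have H1 := @prod_sg (fun j => m (up j v)) 2 b (depth v).+1 b0 isT (fun j => mM _).
  have H2 := @prod_sg (fun j => m (up j v')) b.+1 b (depth v').+1 b0 b0 (fun j => mM _).
  have H3 : \prod_(2 <= j < b.+1) (j%:R / j.-1%:R) ^+ m (up j v') <= b%:R ^+ M :> R.
    apply: le_trans (prod_pow_le _) _.
      move=> j /andP[j2 jb]; split=> //.
      by rewrite ler_pdivlMr ?mul1r ?ler_nat ?ltr0n; lia.
    rewrite (@prod_ratio _ (fun j => j%:R)) ?divr1 //.
    by move=> j j1; rewrite pnatr_eq0; lia.
  rewrite (@big_cat_nat _ _ _ b.+1 2 (depth v').+1) //=.
  have prod0 i k w : 0 <= \prod_(i <= j < k) (j%:R / j.-1%:R) ^+ m (up j w) :> R.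
    by rewrite prodr_ge0 // => j _; rewrite exprn_ge0 // divr_ge0.
  apply: le_trans (ler_pM (prod0 _ _ _) _ H1 (ler_pM (prod0 _ _ _) (prod0 _ _ _) H3 H2)) _.
    by rewrite mulr_ge0.
  rewrite (_ : 4 ^+ M = 2 ^+ M * 2 ^+ M :> R); last by rewrite -exprMn -natrM.
  by rewrite le_eqVlt; apply/orP; left; apply/eqP; rewrite /m; ring.
have Ss : meetS R v x * meetS R v' x <= b%:R * (meetS R v x + meetS R v' x).
  by rewrite /meetS -natrD -!natrM ler_nat; have := meetd_min x v v'; rewrite -/b; nia.
rewrite mulrACA; apply: le_trans (ler_pM _ _ digs Ss) _; rewrite ?mulr_ge0 ?dig_ge0 //.
by rewrite le_eqVlt; apply/orP; left; apply/eqP; rewrite /D exprSr; ring.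
Qed.

End SecondMoment.

(** * Transience *)

Section Series.
Variables (R : realType) (M : nat) (g : R).
Hypothesis g_gt : M%:R + 1 < g.

Lemma expr_diff_le k : (0 < k)%N ->
  k%:R ^+ M.+1 - k.-1%:R ^+ M.+1 <= M.+1%:R * k%:R ^+ M :> R.
Proof.
case: k => // k _; rewrite subrXX /= -[in leLHS]natrB // subSnn mul1r.
apply: (@le_trans _ _ (\sum_(i < M.+1) k.+1%:R ^+ M)).
  apply: ler_sum => i _; have iM : (i <= M)%N by rewrite -ltnS.
  rewrite -[in leRHS](subnK iM) exprD ler_wpM2l ?exprn_ge0 //.
  by rewrite lerXn2r ?nnegrE // ler_nat.
by rewrite big_const card_ord iter_addr_0 mulr_natl.
Qed.

(** Bernoulli's inequality [1 + d / k <= (1 - 1 / k) `^ (- d)] makes the sum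
    telescope. *)
Lemma powR_telescope (d : R) k : 0 < d -> (1 < k)%N ->
  k%:R `^ (- d - 1) <= d^-1 * (k.-1%:R `^ (- d) - k%:R `^ (- d)).
Proof.
move=> d0 k1; have k0 : 0 < k%:R :> R by rewrite ltr0n; lia.
have k10 : 0 < k.-1%:R :> R by rewrite ltr0n; lia.
rewrite mulrC ler_pdivlMr //.
have -> : k.-1%:R = k%:R * (1 - k%:R^-1) :> R.
  by rewrite mulrBr mulr1 divff ?gt_eqF // -subn1 natrB //; lia.
have q0 : 0 < 1 - k%:R^-1 :> R.
  by rewrite subr_gt0 invf_lt1 // ltr1n.
rewrite (powRM _ (ltW k0) (ltW q0)) -[X in _ <= _ - X]mulr1 -mulrBr.
rewrite powRD; last by rewrite (gt_eqF k0) implybT.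
rewrite powR_inv1 ?(ltW k0) // -mulrA ler_wpM2l ?powR_ge0 //.
rewrite lerBrDr /powR (gt_eqF q0); apply: le_trans (expR_ge1Dx _).
rewrite addrC lerD2l mulNr -mulrN mulrC ler_wpM2l ?(ltW d0) //.
by rewrite lerNr; apply: le_ln1Dx; rewrite ltrN2 invf_lt1 // ltr1n.
Qed.

Lemma energy_series : exists2 E : R, 0 < E &
  forall n, \sum_(1 <= k < n.+2) (k%:R ^+ M.+1 - k.-1%:R ^+ M.+1) * k%:R `^ (- g) <= E.
Proof.
pose d := g - (M%:R + 1); have d0 : 0 < d by rewrite subr_gt0.
exists (M.+1%:R * (1 + d^-1)).
  by rewrite mulr_gt0 // addr_gt0 // invr_gt0.
move=> n; suff : \sum_(1 <= k < n.+2) (k%:R ^+ M.+1 - k.-1%:R ^+ M.+1) * k%:R `^ (- g) <=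
    M.+1%:R * (1 + d^-1 * (1 - n.+1%:R `^ (- d))).
  move=> /le_trans; apply; rewrite ler_wpM2l // lerD2l -[leRHS]mulr1.
  by rewrite ler_wpM2l ?invr_ge0 ?ltW // gerBl powR_ge0.
have term k : (0 < k)%N -> (k%:R ^+ M.+1 - k.-1%:R ^+ M.+1) * k%:R `^ (- g) <=
    M.+1%:R * k%:R `^ (- d - 1).
  move=> k0; apply: le_trans (ler_wpM2r (powR_ge0 _ _) (expr_diff_le k0)) _.
  rewrite -mulrA -powR_mulrn // -powRD; last by rewrite pnatr_eq0 -lt0n k0 implybT.
  by rewrite (_ : M%:R + - g = - d - 1) // /d; lra.
elim: n => [|n IHn].
  rewrite big_nat1; apply: le_trans (term 1%N isT) _.
  by rewrite !powR1 subrr mulr0 addr0.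
rewrite big_nat_recr //=; apply: le_trans (lerD IHn (term n.+2 isT)) _.
rewrite -mulrDr ler_wpM2l //.
have := @powR_telescope d n.+2 d0 isT => /= H.
by rewrite -addrA lerD2l; apply: le_trans (lerD (lexx _) H) _; rewrite -mulrDr addrA subrK.
Qed.

End Series.

Section Transience.
Variable T : rooted_tree.
Hypothesis lf : locally_finite T.
Hypothesis infT : infinite_tree T.
Variable M : nat.
Variable R : realType.
Implicit Types (u v x c : T) (s t : seq T).

Section Start.
Variables (c : T) (s : seq T).
Hypothesis c_depth : depth c = 1%N.
Hypotheses (s_reach : reachable M s) (s_alive : alive M s) (s_dug : dug M s c).
Hypotheses (s_head : head root s = c) (s_low : forall y, y \in s -> (depth y <= 1)%N).

Lemma start_started : started M s.
Proof. by apply/startedP; exists c => //; rewrite -depth_eq0 c_depth. Qed.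

Lemma hval_start U (S : T -> R) : (forall u, u \in U -> (1 < depth u)%N) -> hval M U S s = S c.
Proof.
move=> Ud; rewrite /hval s_alive /pos s_head s_dug dig_fresh ?mul1r // => u /Ud du.
by apply/negP => /s_low; lia.
Qed.

Lemma branch_gt1 i u v : (1 < i)%N -> u \in branch i v -> (1 < depth u)%N.
Proof. by move=> i1; rewrite mem_branch => /andP[_]; apply: leq_trans. Qed.

(** The Paley-Zygmund argument. The mixture [Z] of the martingales [hval] of the
    vertices of a level, weighted by the flow, is a martingale until the walk can
    reach that level. It vanishes when the walk dies and its second moment is bounded
    by the energy of the flow, so the walk survives with a probability that does not
    depend on the level. *)
Lemma alive_ge (cap : nat -> R) (r n : nat) (E : R) :
  (forall k, 0 <= cap k) -> (size s + n <= r.+1)%N -> 0 < E ->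
  \sum_(1 <= k < r.+2) (k%:R ^+ M.+1 - k.-1%:R ^+ M.+1) * cap k <= E ->
  maxflow cap r c <= 2 * 4 ^+ M * E * expect M n (fun t => (alive M t)%:R) s.
Proof.
move=> cap0 sn E0 EE; set C := 2 * 4 ^+ M * E.
have C0 : 0 < C by rewrite !mulr_gt0 ?exprn_gt0.
pose th := flow cap c r; pose L := level c r.
have thL v : v \in L -> 0 <= th r v.
  by move=> vL; have /andP[] := flow_bound lf cap0 (leqnn r) vL.
have cL v : v \in L -> meetd c v = 1%N.
  by move=> vL; rewrite meetd_anc // (level_anc lf vL).
have dL v : v \in L -> depth v = r.+1.
  by move=> vL; rewrite (level_depth lf vL) c_depth.
have bL v v' : v \in L -> v' \in L -> (0 < meetd v v')%N.
  move=> vL vL'; apply: leq_trans (meetd_min c v v').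
  by rewrite !cL.
pose h v := hval M (branch 2 v) (meetS R v).
pose Z t := \sum_(v <- L) th r v * h v t.
have tot : \sum_(v <- L) th r v = maxflow cap r c.
  apply: (th_total (r := r)) => // j y jr yl.
  exact: flow_conserved.
have EZ : expect M n Z s = maxflow cap r c.
  rewrite (expect_sum lf infT) -tot big_seq [RHS]big_seq; apply: eq_bigr => v vL.
  rewrite expectZ expect_hval ?start_started ?dL // hval_start; last first.
    by move=> u; apply: branch_gt1.
  by rewrite /meetS cL // mulr1.
pose H v v' := hval M (branch 2 v ++ branch (meetd v v').+1 v') (fun x => meetS R v x + meetS R v' x).
have EZ2 : expect M n (fun t => Z t ^+ 2) s <= C * maxflow cap r c.
  pose K v v' : R := th r v * th r v' * (4 ^+ M * (meetd v v')%:R ^+ M.+1).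
  apply: (@le_trans _ _ (expect M n (fun t => \sum_(v <- L) \sum_(v' <- L) K v v' * H v v' t) s)).
    apply: expect_le => // t vt _; rewrite expr2 /Z mulr_suml.
    rewrite big_seq [leRHS]big_seq; apply: ler_sum => v vL.
    rewrite mulr_sumr big_seq [leRHS]big_seq; apply: ler_sum => v' vL'.
    rewrite mulrACA /K -(mulrA (th r v * th r v')) ler_wpM2l ?mulr_ge0 ?thL //.
    exact: hval_pair (bL _ _ vL vL').
  apply: (@le_trans _ _ (\sum_(v <- L) \sum_(v' <- L) K v v' * 2)).
    rewrite (expect_sum lf infT) big_seq [leRHS]big_seq; apply: ler_sum => v vL.
    rewrite (expect_sum lf infT) big_seq [leRHS]big_seq; apply: ler_sum => v' vL'.
    rewrite expectZ ler_wpM2l ?mulr_ge0 ?thL ?exprn_ge0 //.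
    have -> : 2 = H v v' s.
      rewrite /H hval_start /meetS ?cL // => u; rewrite mem_cat => /orP[]; apply: branch_gt1 => //.
      exact: bL.
    apply: (expect_superharmonic (Q := fun t => started M t) n s_reach start_started).
      by move=> t u _ st _; exact: started_cons.
    by move=> t vt st; apply: hval_superharmonic => //; apply/pair_potential/bL.
  have := @energy_le T lf R cap c r th (fun k => k%:R ^+ M.+1 : R).
  have thb j x : (j <= r)%N -> x \in level c j -> 0 <= th j x <= cap (depth x).
    move=> jr xl; have /andP[-> /= ub] := flow_bound lf cap0 jr xl.
    exact: le_trans ub (maxflow_cap _ _ _).
  move=> /(_ thb _ _ c_depth _ cap0) EN.
  apply: (@le_trans _ _ (2 * 4 ^+ M * energy c th (fun k => k%:R ^+ M.+1) r)).
    rewrite le_eqVlt; apply/orP; left; apply/eqP; rewrite /energy mulr_sumr.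
    apply: eq_bigr => v _; rewrite mulr_sumr; apply: eq_bigr => v' _; rewrite /K; ring.
  rewrite /C -[leRHS]mulrA ler_wpM2l ?mulr_ge0 ?exprn_ge0 //.
  apply: (le_trans (EN _ _ _)).
  - by move=> j y jr yl; apply: flow_conserved.
  - by move=> k; rewrite lerXn2r ?nnegrE // ler_nat.
  - by rewrite expr0n.
  by rewrite mulrC ler_wpM2r // maxflow_ge0.
(* Young's inequality on the survival event, outside of which [Z = 0] *)
have : expect M n Z s <= expect M n (fun t => (2 * C)^-1 * Z t ^+ 2 + C / 2 * (alive M t)%:R) s.
  apply: expect_le => // t vt _.
  case: (boolP (alive M t)) => [_|ds]; last first.
    suff -> : Z t = 0 by rewrite expr0n mulr0 mulr0 addr0.
    by rewrite /Z big1 // => v _; rewrite /h /hval (negbTE ds) mul0r mulr0.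
  have : 0 <= (2 * C)^-1 * (Z t - C) ^+ 2 by rewrite mulr_ge0 ?sqr_ge0 // invr_ge0 mulr_ge0 // ltW.
  suff -> : (2 * C)^-1 * (Z t - C) ^+ 2 = (2 * C)^-1 * Z t ^+ 2 + C / 2 * true%:R - Z t by rewrite subr_ge0.
  have -> : (nat_of_bool true)%:R = 1 :> R by [].
  by field; rewrite gt_eqF.
rewrite expectD !expectZ EZ => le1.
have le2 : (2 * C)^-1 * expect M n (fun t => Z t ^+ 2) s <= maxflow cap r c / 2.
  rewrite invfM -mulrA mulrC ler_wpM2r // ler_pdivrMl //.
lra.
Qed.

End Start.

Let deg : R := (size (nb (@Defs.root T)))%:R.

Lemma deg_gt0 : 0 < deg.
Proof. by rewrite ltr0n nb_root_gt0. Qed.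

(** With positive probability the walk goes back and forth between the root and [c]
    until all cookies at [c] are eaten. *)
Lemma back_and_forth c j : c \in ch root -> (j <= M)%N ->
  exists s, [/\ reachable M s, alive M s, head root s = root,
    (forall y, y \in s -> y = root \/ y = c) & count_mem c s = j /\ size s = (2 * j).+1] /\
  forall (F : seq T -> R) k, (forall t, reachable M t -> 0 <= F t) ->
    deg ^- j * expect M k F s <= expect M (2 * j + k) F [:: root].
Proof.
move=> cr; have := cr; rewrite mem_ch // => /andP[nc /eqP pc].
elim: j => [_|j IHj jM].
  exists [:: root]; split=> [|F k _]; last by rewrite expr0 invr1 mul1r.
  split=> //; first by rewrite /= eqxx.
    by move=> y; rewrite inE => /eqP; left.
  by rewrite /= eq_sym (negbTE nc).
have [s [[vs als hs mems [cs ss]] sF]] := IHj (ltnW jM).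
have s1 : c \in moves M s by rewrite /moves hs reachable_dug_root // -ch_root.
have vs1 := reachable_cons vs s1.
have nf : dug M (c :: s) c = false.
  by rewrite /dug /cookies (negbTE nc) /= eqxx cs add1n; apply/negbTE; rewrite -leqNgt.
have m2 : moves M (c :: s) = [:: root] by rewrite /moves /= nf pc.
have vs2 : reachable M (root :: c :: s) by apply: (reachable_cons vs1); rewrite m2 inE.
have nst : ~~ started M (c :: s).
  apply/hasPn => y; rewrite inE negb_and negbK => yin.
  have [->|->] : y = root \/ y = c by case/orP: yin => [/eqP ->|/mems]; [right|].
    by rewrite eqxx.
  by rewrite nf orbT.
exists (root :: c :: s); split.
  split=> //.
  - apply/andP; split; last by rewrite (negbTE nst).
    by apply/andP; split; rewrite // (negbTE nc) andbF.
  - move=> y; rewrite !inE => /orP[/eqP|/orP[/eqP|/mems]]; [by left|by right|by []].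
  - by rewrite /= [root == c]eq_sym (negbTE nc) eqxx cs ss mulnS.
move=> F k F0; have -> : (2 * j.+1 + k = 2 * j + k.+2)%N by rewrite mulnS add2n !addSn !addnS.
apply: le_trans (sF F k.+2 F0); rewrite exprSr invfM -mulrA.
rewrite ler_wpM2l ?invr_ge0 ?exprn_ge0 ?ler0n //.
have F1 t : reachable M t -> 0 <= expect M k.+1 F t by move=> vt; apply: expect_ge0.
rewrite expectS; apply: le_trans (step_ge F1 vs s1).
rewrite /moves hs reachable_dug_root // mulrC ler_wpM2r ?invr_ge0 ?ler0n //.
by rewrite expectS /step m2 big_seq1 divr1.
Qed.

Lemma expect_alive_antitone n m s : reachable M s -> (n <= m)%N ->
  expect M m (fun t => (alive M t)%:R) s <= expect M n (fun t => (alive M t)%:R) s :> R.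
Proof.
move=> vs /subnKC <-; elim: (m - n)%N => [|k IHk]; first by rewrite addn0.
rewrite addnS expectSr; apply: le_trans IHk; apply: expect_le => // t vt _.
rewrite -[leRHS](step_const lf infT M _ t); apply: step_le => u us.
by rewrite ler_nat /=; case: (alive M t) => //=; apply: leq_b1.
Qed.

(** The child [c] of the root may depend on the level of the flow; the bound does
    not, because [c] carries at least the average flow. *)
Lemma expect_alive_lower (g kappa : R) : M%:R + 1 < g -> 0 < kappa ->
  (forall pi : set (T * T), is_cutset pi -> (kappa%:E <= cutset_sum g pi)%E) ->
  exists2 e : R, 0 < e &
    forall n, e <= expect M n (fun t : seq T => (alive M t)%:R) [:: root].
Proof.
move=> g_gt k0 cutk; have [E E0 HE] := energy_series g_gt.
pose cap k : R := k%:R `^ (- g); have cap0 k : 0 <= cap k by exact: powR_ge0.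
exists (deg ^- M.+1 * (kappa / deg / (2 * 4 ^+ M * E))).
  by rewrite !mulr_gt0 ?invr_gt0 ?exprn_gt0 ?deg_gt0 ?mulr_gt0 ?exprn_gt0.
move=> n.
(* [n] steps after the start, the walk cannot have reached depth [r + 1] *)
pose r := ((2 * M).+2 + n)%N.
have [c cr cflow] : exists2 c : T, c \in ch root & kappa / deg <= maxflow cap r c.
  apply: contrapT => none; have := cutk _ (root_cutset lf cap r).
  move=> H; have := le_trans H (@root_cut_sum T R cap r g (fun k => erefl)).
  rewrite lee_fin leNgt {H} => /negP; apply.
  have kE : kappa = \sum_(c <- ch (@Defs.root T)) (kappa / deg).
    rewrite big_const_seq count_predT iter_addr_0 ch_root // -mulr_natr divfK //.
    by rewrite gt_eqF // deg_gt0.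
  rewrite [ltRHS]kE big_seq [ltRHS]big_seq; apply: ltr_sum => [|c cr].
    have : (0 < size (nb (@Defs.root T)))%N by exact: nb_root_gt0.
    rewrite -ch_root // -has_predT => /hasP[y yr _]; by apply/hasP; exists y.
  by rewrite ltNge; apply/negP => cF; apply: none; exists c.
have [s [[vs als hs mems [cs ss]] sF]] := back_and_forth cr (leqnn M).
have := cr; rewrite mem_ch // => /andP[nc /eqP pc].
have dc : depth c = 1%N by rewrite (depth_parent nc) pc depth_root.
have s1 : c \in moves M s by rewrite /moves hs reachable_dug_root // -ch_root.
have vs1 := reachable_cons vs s1.
have als1 : alive M (c :: s) by apply/andP; split; rewrite // (negbTE nc) andbF.
have fc : dug M (c :: s) c by rewrite /dug /cookies (negbTE nc) /= eqxx cs.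
have low y : y \in c :: s -> (depth y <= 1)%N.
  rewrite inE => /orP[/eqP ->|/mems[->|->]]; rewrite ?dc //.
  by rewrite depth_root.
have sn : (size (c :: s) + n <= r.+1)%N by rewrite /= ss; exact: leqnSn.
have := alive_ge dc vs1 als1 fc erefl low cap0 sn E0 (HE r).
move=> /(le_trans cflow) bound.
have r0 : reachable M [:: root : T] by rewrite /= eqxx.
apply: le_trans (expect_alive_antitone (m := (2 * M + n.+1)%N) r0 _); last first.
  by rewrite addnS leqW // leq_addl.
have al0 (t : seq T) : reachable M t -> 0 <= (alive M t)%:R :> R by [].
apply: le_trans (sF (fun t => (alive M t)%:R) n.+1 al0).
rewrite exprSr (invfM (deg ^+ _)) -(mulrA (deg ^- M)) ler_wpM2l ?invr_ge0 ?exprn_ge0 ?ler0n //.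
rewrite expectS; apply: le_trans (step_ge _ vs s1); last first.
  by move=> t vt; apply: expect_ge0.
rewrite /moves hs reachable_dug_root // mulrC ler_wpM2r ?invr_ge0 ?ler0n //.
by rewrite ler_pdivrMr 1?[leRHS]mulrC // !mulr_gt0 ?exprn_gt0.
Qed.

End Transience.

(** * The walk as a random process *)

Section Paths.
Variable T : rooted_tree.
Variable M : nat.
Implicit Types (x : nat -> T) (u v : T) (s : seq T).

Fixpoint hist x n : seq T := if n is n'.+1 then x n :: hist x n' else [:: x 0%N].

Lemma head_hist x n : head root (hist x n) = x n.
Proof. by case: n. Qed.

Lemma mem_hist x n : x n \in hist x n.
Proof. by case: n => [|n]; rewrite mem_head. Qed.

Lemma local_timeE x n v : local_time x n v = count_mem v (hist x n).
Proof.
rewrite /local_time; elim: n => [|n IHn]; first by rewrite big_ord1 /= addn0.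
by rewrite big_ord_recr /= IHn addnC.
Qed.

Lemma eq_hist x y n : (forall k, (k <= n)%N -> x k = y k) <-> hist x n = hist y n.
Proof.
elim: n => [|n IHn] /=.
  split=> [H|[e] k]; first by rewrite H.
  by rewrite leqn0 => /eqP ->.
split=> [H|[e /IHn H] k].
  by rewrite H //; congr (_ :: _); apply/IHn => k kn; apply: H; apply: leqW.
by rewrite leq_eqVlt => /orP[/eqP -> //|]; rewrite ltnS; exact: H.
Qed.

Lemma started_consE s u : started M (u :: s) = started M s || (u != root) && dug M (u :: s) u.
Proof.
apply/idP/orP => [/startedP [v vr fv]|[|/andP[ur fu]]]; last 2 first.
- exact: started_cons.
- by apply/startedP; exists u.
have [e|uv] := eqVneq u v; first by right; rewrite e vr -{1}e.
by left; apply/startedP; exists v; rewrite // -(dug_consN M s uv).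
Qed.

Lemma started_hist x n : x 0%N = root -> started M (hist x n) <->
  exists2 j, (j <= n)%N & x j != root /\ dug M (hist x j) (x j).
Proof.
move=> x0; elim: n => [|n IHn].
  rewrite /= x0 /started /= eqxx; split=> // -[j]; rewrite leqn0 => /eqP ->.
  by rewrite x0 eqxx => -[].
rewrite [hist _ _]/= started_consE; split=> [/orP[/IHn [j jn H]|/andP[xr fx]]|[j]].
- by exists j => //; apply: leqW.
- by exists n.+1.
rewrite leq_eqVlt => /orP[/eqP -> [xr fx]|]; first by apply/orP; right; rewrite xr.
by rewrite ltnS => jn H; apply/orP; left; apply/IHn; exists j.
Qed.

Lemma alive_hist x : x 0%N = root -> (forall n, alive M (hist x n)) <->
  (forall j k, (j < k)%N -> x j != root -> dug M (hist x j) (x j) -> x k != root).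
Proof.
move=> x0; split=> [al j [//|k] jk xj fj|H].
  have /andP[_] := al k.+1; rewrite negb_and => /orP[|//].
  by move/negP=> ns; case: ns; apply/started_hist => //; exists j.
elim=> [|n IHn] //.
apply/andP; split=> //; rewrite negb_and; have [st|//] := boolP (started M _).
by have /started_hist [//|j jn [xj fj]] := st; rewrite (H j).
Qed.

(** The candidates for the stop that follows a stop at time [t]. *)
Definition stops x t := [set k | [/\ (t < k)%N, x k <> x t &
  (cookies M (x k) + 1 <= local_time x k (x k))%N]]%classic.

Lemma stop_dug x k : (cookies M (x k) + 1 <= local_time x k (x k))%N = dug M (hist x k) (x k).
Proof. by rewrite addn1 local_timeE. Qed.

Lemma sigmaS x n : sigma M x n.+1 = if sigma M x n is Some t then inf_nat (stops x t) else None.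
Proof. by []. Qed.

(** The first stop after time [0] is the first time when a vertex other than the root
    is dug. From then on every visit to the root is a stop, because the root is always
    dug and the previous stop, if it is not a return itself, is elsewhere. *)
Lemma return_time_alive x : x 0%N = root ->
  return_time M x = None <-> forall n, alive M (hist x n).
Proof.
move=> x0; rewrite /return_time inf_nat_None alive_hist //; split=> [noret j k jk xj fj|H n].
  apply/negP => /eqP xk.
  have xk_dug t : (t < k)%N -> x t != root -> stops x t k.
    move=> tk xt; split=> //; first by rewrite xk; apply/eqP; rewrite eq_sym.
    by rewrite xk /cookies eqxx add0n local_timeE -has_count has_pred1 -xk mem_hist.
  suff H n : exists t, [/\ sigma M x n = Some t, (t < k)%N & (n <= t)%N].
    by have [t [_ tk kt]] := H k; move: (leq_trans tk kt); rewrite ltnn.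
  elim: n => [|n [t [st tk nt]]]; first by exists 0%N; split=> //; lia.
  have [t' [t't t'k]] : exists t', stops x t t' /\ (t' <= k)%N /\ (x t' != root \/ n != 0%N).
    have [n0|n0] := eqVneq n 0%N.
      have t0 : t = 0%N by move: st; rewrite n0 /= => -[].
      exists j; split; last by split; [exact: ltnW|left].
      rewrite t0; split.
      - by rewrite lt0n; apply: contraNneq xj => ->; rewrite x0.
      - by rewrite x0; apply/eqP.
      - by rewrite stop_dug.
    exists k; split; last by split=> //; right.
    apply: xk_dug => //; apply/eqP => xt; apply: (noret n); split; first by rewrite lt0n.
    by rewrite /xtilde st /= xt.
  have [t'' e] := inf_nat_ex t't; have [[tt'' _ _] min''] := (inf_natP _ _).1 e.
  have t''k := leq_trans (min'' _ t't) t'k.1.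
  have s'' : sigma M x n.+1 = Some t'' by rewrite sigmaS st.
  exists t''; split=> //; last exact: leq_ltn_trans nt tt''.
  rewrite ltn_neqAle t''k andbT; apply/eqP => e''; apply: (noret n.+1).
  by split=> //; rewrite /xtilde s'' /= e'' xk.
case; case: n => // n _; rewrite /xtilde; case st: (sigma M x n.+1) => [k|//] [xk].
have first m k' : sigma M x m.+1 = Some k' ->
    exists2 j, (j <= k')%N & x j != root /\ dug M (hist x j) (x j).
  elim: m k' => [|m IHm] k'; rewrite sigmaS.
    move=> /inf_natP [[_ ne fk] _]; exists k' => //; rewrite -stop_dug; split=> //.
    by apply/eqP => e; apply: ne; rewrite e x0.
  case: (sigma M x m.+1) IHm => // t IHm /inf_natP [[tk _ _] _].
  by have [j jt Hj] := IHm t erefl; exists j; rewrite // (leq_trans jt) // ltnW.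
have [j jk [xj fj]] := first n k st.
have := H j k; rewrite ltn_neqAle jk andbT => /(_ _ xj fj).
by rewrite xk eqxx => F; apply/notF/F; apply: contraNneq xj => ->; rewrite xk.
Qed.

End Paths.

Section Process.
Local Open Scope classical_set_scope.
Variable T : rooted_tree.
Hypothesis lf : locally_finite T.
Hypothesis infT : infinite_tree T.
Variables (M : nat) (R : realType) (d : measure_display) (Omega : measurableType d).
Variables (P : probability Omega R) (X : nat -> Omega -> T).
Hypothesis X_DRW : is_DRW M P X.
Implicit Types (u v : T) (s : seq T) (B : pred (seq T)).

Lemma moves_uniq s : uniq (moves M s).
Proof. by rewrite /moves; case: ifP => // _; apply: nb_uniq. Qed.

Lemma sum_moves s : reachable M s ->
  \sum_(u <- nb (head root s)) (u \in moves M s)%:R = (size (moves M s))%:R :> R.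
Proof.
move=> vs; rewrite -natr_sum; congr (_%:R).
have sub u : u \in moves M s -> u \in nb (head root s).
  by move=> us; rewrite mem_nb //; exact: (moves_adj lf vs us).
rewrite (eq_bigr (fun u => if u \in moves M s then 1 else 0)%N); last by move=> u _; case: ifP.
rewrite -big_mkcond sum1_count -size_filter; apply/perm_size/uniq_perm.
- exact/filter_uniq/nb_uniq.
- exact: moves_uniq.
by move=> u; rewrite mem_filter; case: (boolP (u \in moves M s)) => // /sub ->.
Qed.

Lemma weight_edge (x : nat -> T) n u : reachable M (hist x n) -> adj (x n) u ->
  weight M x n (edge (x n) u) = (u \in moves M (hist x n)).
Proof.
move=> vs xu; have wE e : weight M x n e = dug M (hist x n) e.1.
  by rewrite /weight local_timeE /dug ltnNge; case: leq.
rewrite wE /edge /moves head_hist; move: (xu); rewrite adjP => /orP[/andP[xr /eqP e]|/andP[ur /eqP e]].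
  have dx : depth (x n) = (depth u).+1 by rewrite (depth_parent xr) -e.
  rewrite (_ : (depth (x n) < depth u)%N = false) /=; last by lia.
  have fu : dug M (hist x n) u by rewrite e; apply: (reachable_parent lf) => //; apply: mem_hist.
  by rewrite fu; case: ifP => _; [rewrite mem_nb ?xu|rewrite e mem_head].
have du : depth u = (depth (x n)).+1 by rewrite (depth_parent ur) -e.
rewrite (_ : (depth (x n) < depth u)%N = true) /=; last by lia.
case: ifP => _; first by rewrite mem_nb ?xu.
rewrite inE (_ : (u == parent (x n)) = false) //; apply/eqP => e'.
by move: du; rewrite e' depth_parentE; lia.
Qed.

Lemma step_probE (x : nat -> T) n v : reachable M (hist x n) -> adj (x n) v ->
  step_prob M R x n v = (v \in moves M (hist x n))%:R / (size (moves M (hist x n)))%:R.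
Proof.
move=> vs xv; rewrite /step_prob weight_edge //; congr (_ / _).
rewrite fsbig_finite /=; last exact: lf.
rewrite -(sum_moves vs) head_hist -/(nb (x n)) big_seq [RHS]big_seq.
by apply: eq_bigr => u; rewrite mem_nb // => xu; rewrite weight_edge.
Qed.

Lemma level_root v : v \in level root (depth v).
Proof.
elim/tree_ind: v => [|v vr IHv]; first by rewrite depth_root mem_head.
rewrite (depth_parent vr) /=; apply/flattenP; exists (ch (parent v)); first exact: map_f.
by rewrite mem_ch // vr eqxx.
Qed.

(** Hence any event about finitely many steps is measurable. *)
Lemma vertices_countable : countable [set: T].
Proof.
apply: (@sub_countable _ _ _ (\bigcup_k [set` level root k])%classic); last first.
  by apply: bigcup_countable => // k _; apply/finite_set_countable/finite_seq.
by apply: subset_card_le => v _; exists (depth v) => //; exact: level_root.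
Qed.

Definition path_to w n : seq T := hist (fun k => X k w) n.

Lemma measurable_hist n B : measurable [set w | B (path_to w n)].
Proof.
have [mX _ _] := X_DRW.
elim: n B => [|n IHn] B.
  have -> : [set w | B (path_to w 0)] = (\bigcup_v [set w | X 0%N w = v /\ B [:: v]])%classic.
    apply/seteqP; split=> [w Bw|w [v _ [/= e Bv]]]; first by exists (X 0%N w).
    by rewrite /path_to /= e.
  apply: countable_bigcupT_measurable; first exact: vertices_countable.
  move=> v; case: (B [:: v]).
    rewrite (_ : [set w | _] = X 0%N @^-1` [set v])%classic; first exact: mX.
    by apply/seteqP; split=> w //= [].
  rewrite (_ : [set w | _] = set0)%classic; first exact: measurable0.
  by apply/seteqP; split=> w //= [].
have -> : [set w | B (path_to w n.+1)] =
    (\bigcup_v (X n.+1 @^-1` [set v] `&` [set w | [pred s | B (v :: s)] (path_to w n)]))%classic.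
  apply/seteqP; split=> [w Bw|w [v _ [/= e Bv]]]; first by exists (X n.+1 w).
  by rewrite /path_to /= e.
apply: countable_bigcupT_measurable; first exact: vertices_countable.
by move=> v; apply: measurableI; [exact: mX|exact: IHn].
Qed.

Definition cyl n s : set Omega := [set w | path_to w n = s]%classic.

Lemma measurable_cyl n s B k : measurable (cyl n s `&` [set w | B (path_to w k)])%classic.
Proof.
apply: measurableI; last exact: measurable_hist.
rewrite (_ : cyl n s = [set w | (pred1 s) (path_to w n)])%classic; first exact: measurable_hist.
by apply/seteqP; split=> w /= /eqP.
Qed.

Lemma measurable_cyl1 n s : measurable (cyl n s).
Proof.
rewrite -[cyl n s]setIT (_ : setT = [set w | xpredT (path_to w 0)]).
  exact: (measurable_cyl n s xpredT 0).
by apply/seteqP; split.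
Qed.

Lemma cyl_next n s u (p : R) : reachable M s -> u \in moves M s -> P (cyl n s) = p%:E ->
  P (cyl n.+1 (u :: s)) = (p / (size (moves M s))%:R)%:E.
Proof.
move=> vs us Pp; have [mX _ tr] := X_DRW.
have E : (cyl n.+1 (u :: s) = X n.+1 @^-1` [set u] `&` cyl n s)%classic.
  apply/seteqP; split=> w /=; rewrite /cyl /path_to /=; first by case.
  by case=> -> ->.
have mXs := measurableI _ _ (mX n.+1 u) (measurable_cyl1 n s).
have le_p : (P (cyl n.+1 (u :: s)) <= p%:E)%E.
  rewrite -Pp E; apply: le_measure; rewrite ?inE //.
    exact: measurable_cyl1.
have p0 : (0 <= p)%R by rewrite -lee_fin -Pp measure_ge0.
have [e|pn0] := eqVneq p 0.
  rewrite e mul0r; apply/eqP; rewrite eq_le measure_ge0 andbT.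
  by rewrite -e.
have [w ws] : (cyl n s !=set0)%classic.
  by apply/set0P/eqP => e; move: Pp; rewrite e measure0 => -[e0]; rewrite -e0 eqxx in pn0.
pose x k := X k w; have hx : hist x n = s by [].
have histE : history X n x = cyl n s.
  by apply/seteqP; split=> z /= H; [rewrite -hx; apply/eq_hist|apply/eq_hist; rewrite hx].
have xu : adj (x n) u by rewrite -(head_hist x n) hx; apply: (moves_adj lf vs).
have := tr n x u xu; rewrite histE Pp lte_fin lt0r pn0 p0 => /(_ isT).
rewrite step_probE ?hx // us mul1r /cond_prob Pp -E /= => H.
rewrite -[LHS]fineK; last by rewrite E fin_num_measure.
by congr (_%:E); rewrite -H mulrC divfK.
Qed.

(** The cylinders that extend [s] by an allowed move are disjoint subsets of the
    cylinder of [s], which gives an inequality. Applying it to the complement of [B]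
    as well yields the equality [prob_expect], without a discussion of the null set of
    paths that make other moves. *)
Lemma prob_expect_le k n s B (p : R) : reachable M s -> P (cyl n s) = p%:E ->
  ((p * expect M k (fun t => (B t)%:R) s)%:E <=
    P (cyl n s `&` [set w | B (path_to w (n + k))]))%E.
Proof.
elim: k n s p => [|k IHk] n s p vs Pp.
  rewrite /expect /= addn0; case Bs: (B s); last by rewrite mulr0 measure_ge0.
  rewrite mulr1 -Pp le_measure ?inE //; [exact: measurable_cyl1|exact: measurable_cyl|].
  by move=> w ws; split=> //=; rewrite ws.
pose D u := (cyl n.+1 (u :: s) `&` [set w | B (path_to w (n.+1 + k))])%classic.
apply: (@le_trans _ _ (P (\bigcup_(u in [set` moves M s]) D u))%E); last first.
  rewrite le_measure ?inE //.
  - apply: fin_bigcup_measurable; first exact: finite_seq.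
    by move=> u _; apply: measurable_cyl.
  - exact: measurable_cyl.
  by move=> w [u _ [[_ ws] Bw]]; split=> //; rewrite /= -addSnnS.
rewrite measure_fin_bigcup; [|exact: finite_seq| |by move=> u _; apply: measurable_cyl]; last first.
  by move=> u v _ _ [w [[+ _] [+ _]]]; rewrite /cyl /path_to /= => -[<- _] -[<- _].
rewrite expectS /step -fsbig_seq ?moves_uniq // [_ / _]mulrC mulrA mulr_sumr.
rewrite -sumEFin big_seq [leRHS]big_seq; apply: lee_sum => u us.
by apply: IHk; [exact: reachable_cons|exact: cyl_next].
Qed.

Lemma prob_expect k B :
  P [set w | B (path_to w k)] = (expect M k (fun t => (B t)%:R) [:: root])%:E.
Proof.
have r0 : reachable M [:: root : T] by rewrite /= eqxx.
have cylT : cyl 0 [:: root] = setT.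
  by apply/seteqP; split=> // w _; case: X_DRW => _ X0 _; rewrite /cyl /path_to /= X0.
have Pcyl : P (cyl 0 [:: root]) = 1%:E by rewrite cylT probability_setT.
have low (C : pred (seq T)) : ((expect M k (fun t => (C t)%:R) [:: root])%:E <= P [set w | C (path_to w k)])%E.
  by have := prob_expect_le k C r0 Pcyl; rewrite cylT setTI mul1r.
apply/eqP; rewrite eq_le low andbT.
have := low (predC B).
have -> : [set w | predC B (path_to w k)] = ~` [set w | B (path_to w k)].
  by apply/seteqP; split=> w /=; [move/negP|move=> H; apply/negP].
rewrite probability_setC; last exact: measurable_hist.
have -> : expect M k (fun t => (predC B t)%:R) [:: root] =
    1 - expect M k (fun t => (B t)%:R) [:: root] :> R.
  apply/eqP; rewrite eq_sym subr_eq -expectD -[X in X == _](expect_const lf infT M k 1 [:: root]).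
  apply/eqP; congr (@expect T M R k _ _); apply/funext => t /=.
  by case: (B t); rewrite /= ?addr0 ?add0r.
rewrite -[P _]fineK ?fin_num_measure //; last exact: measurable_hist.
by rewrite -EFinB !lee_fin lerD2l lerN2.
Qed.

Definition alive_event n : set Omega := [set w | alive M (path_to w n)].

Lemma return_time_set :
  [set w | return_time M (fun n => X n w) = None] = \bigcap_n alive_event n.
Proof.
have X0 w : X 0%N w = root by case: X_DRW.
apply/seteqP; split=> w H; have [H1 H2] := @return_time_alive T M (fun n => X n w) (X0 w).
  by move=> n _; apply: H1.
by apply: H2 => n; apply: H.
Qed.

Lemma measurable_alive n : measurable (alive_event n).
Proof. exact: measurable_hist. Qed.

Lemma measurable_return : measurable (\bigcap_n alive_event n).
Proof. by apply: bigcap_measurable => // n _; exact: measurable_alive. Qed.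

Lemma prob_return_le n : (P (\bigcap_n alive_event n) <=
  (expect M n (fun t : seq T => (alive M t)%:R) [:: root])%:E)%E.
Proof.
rewrite -prob_expect; apply: le_measure; rewrite ?inE.
- exact: measurable_return.
- exact: measurable_alive.
by move=> w; apply.
Qed.

Lemma prob_return_ge (e : R) :
  (forall n, e <= expect M n (fun t : seq T => (alive M t)%:R) [:: root]) ->
  (e%:E <= P (\bigcap_n alive_event n))%E.
Proof.
move=> He; have cv := @nonincreasing_cvg_mu _ _ _ P alive_event _ measurable_alive measurable_return _.
have lim_e : (P \o alive_event) x @[x --> \oo] --> P (\bigcap_n alive_event n).
  apply: cv; first by rewrite (le_lt_trans (probability_le1 _ (measurable_alive 0))) ?ltry.
  apply/nonincreasing_seqP => n; apply/subsetPset => w; rewrite /alive_event /path_to /=.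
  by case/andP.
rewrite -(cvg_lim _ lim_e) //; apply: lime_ge; first by apply/cvg_ex; eexists; exact: lim_e.
by apply: nearW => n /=; rewrite prob_expect lee_fin.
Qed.

End Process.

Theorem theorem2 (R : realType) (T : rooted_tree) (M : nat)
    (d : measure_display) (Omega : measurableType d) (P : probability Omega R)
    (X : nat -> Omega -> T)
    (T_infinite : infinite_tree T) (T_locally_finite : locally_finite T)
    (X_DRW : is_DRW M P X) :
  ((br_r R T < (M%:R + 1)%:E)%E -> recurrent M P X) /\
  (((M%:R + 1)%:E < br_r R T)%E -> transient M P X).
Proof.
have M1 : 0 < M%:R + 1 :> R by rewrite natr1 ltr0n.
rewrite /recurrent /transient (return_time_set X_DRW); split=> [br_lt P_gt0|br_gt].
  (* The exponent [M + 1] itself is not admissible in the definition of [br_r]. *)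
  have infs : (ereal_inf [set cutset_sum (M%:R + 1) pi | pi in @is_cutset T]%classic <= (0 : \bar R))%E.
    rewrite leNgt; apply: contraL br_lt => inf_gt0; rewrite -leNgt /br_r le_max.
    apply/orP; right; apply: ereal_sup_ubound; exists (M%:R + 1) => //; split=> //.
  have [p p0 Pp] : exists2 p : R, 0 < p & P (\bigcap_n alive_event M X n)%classic = p%:E.
    have fin : P (\bigcap_n alive_event M X n)%classic \is a fin_num.
      by rewrite fin_num_measure //; exact: (measurable_return T_locally_finite X_DRW).
    by exists (fine (P (\bigcap_n alive_event M X n)%classic)); rewrite ?fineK // -lte_fin fineK.
  have [_ [pi cut <-] pi_lt] : exists2 y, [set cutset_sum (M%:R + 1) pi | pi in @is_cutset T]%classic y
      & (y < (p / 2)%:E)%E.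
    by apply: ereal_inf_lt; rewrite (le_lt_trans infs) // lte_fin divr_gt0.
  have [C HC] := expect_alive_cutset T_locally_finite T_infinite M R cut.
  have bound n : (0 < n)%N -> p / 2 * n%:R < C.
    move=> n0; have n0' : 0 < n%:R :> R by rewrite ltr0n.
    have := le_lt_trans (HC n n0) pi_lt; rewrite lte_fin.
    have := prob_return_le T_locally_finite T_infinite X_DRW n; rewrite Pp lee_fin => h1 h2.
    by rewrite -ltr_pdivlMr //; lra.
  have p2 : 0 < p / 2 by rewrite divr_gt0.
  pose n := (Num.bound `|C / (p / 2)|).+1.
  have : C / (p / 2) < n%:R.
    apply: le_lt_trans (ler_norm _) _.
    by apply: lt_le_trans (archi_boundP (normr_ge0 _)) _; rewrite ler_nat leqnSn.
  rewrite ltr_pdivrMr // [ltRHS]mulrC => /(lt_trans (bound n isT)).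
  by rewrite ltxx.
have [_ [g [g0 inf_gt0] <-] gM] : exists2 y, [set g%:E | g in [set g : R | (0 < g)%R /\
    (0 < ereal_inf [set cutset_sum g pi | pi in @is_cutset T])%E]]%classic y & ((M%:R + 1)%:E < y)%E.
  apply: ereal_sup_gt; move: br_gt; rewrite /br_r lt_max => /orP[|//].
  by rewrite lte_fin ltNge (ltW M1).
rewrite lte_fin in gM.
have [k k0 kinf] : exists2 k : R, 0 < k &
    (k%:E <= ereal_inf [set cutset_sum g pi | pi in @is_cutset T]%classic)%E.
  move: inf_gt0; case: ereal_inf => [r| |] // r0; first by exists r; rewrite // -lte_fin.
  by exists 1; rewrite // leey.
have [e e0 He] := expect_alive_lower T_locally_finite T_infinite gM k0 (fun pi cut =>
  le_trans kinf (ereal_inf_lbound (ex_intro2 _ _ pi cut erefl))).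
apply: (@lt_le_trans _ _ e%:E); first by rewrite lte_fin.
exact: prob_return_ge.
Qed.
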